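(* Let $H>0$ and let $X=(X_t)_{t\geq0}$ be a one-dimensional, centered, $H$-self-similar Gaussian Markov process with covariance function $R(s,t)=\mathbb{E}[X_sX_t]$. Then there exist $c\in[-\infty,-H]$ such that \[ R(s,t)=R(1,1)\,R_{H,c}(s,t),\qquad s,t\geq0, \] with $R(1,1)\geq0$. Consequently $X$ has the same law as $R(1,1)^{1/2}X^{H,c}$.
   Context: A stochastic process $(X_t)_{t\geq0}$ is called $H$-self-similar with exponent $H>0$ if it is stochastically continuous at $0$ and, for every $a>0$, the process $(X_{at})_{t\geq0}$ has the same law as $(a^HX_t)_{t\geq0}$. For $H>0$ and finite $c\leq -H$, define \[ R_{H,c}(s,t)=\begin{cases}(s\vee t)^{2H+c}(s\wedge t)^{-c}, & s\wedge t>0,\\ 0,& s\wedge t=0,\end{cases} \] and define $R_{H,-\infty}(s,t)=\lim_{c\to-\infty}R_{H,c}(s,t)$, i.e. $R_{H,-\infty}(s,t)=t^{2H}$ if $s=t$ and $0$ if $s\neq t$. For $c\in[-\infty,-H]$, $X^{H,c}$ denotes a centered Gaussian process with covariance $R_{H,c}$; for finite $c\le -H$ it can be realized as $X^{H,c}_t=t^{2H+c}W(t^{-2H-2c})$ with $W$ a standard Brownian motion. *)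

(* Defs.v *)
From HB Require Import structures.
From mathcomp Require Import all_boot all_order all_algebra.
From mathcomp Require Import all_classical all_reals all_analysis.
Set Implicit Arguments. Unset Strict Implicit. Unset Printing Implicit Defensive.
Import Order.TTheory GRing.Theory Num.Theory.
Import numFieldNormedType.Exports.
Local Open Scope classical_set_scope.
Local Open Scope ring_scope.

(* Processes indexed by time t >= 0 are modelled as X : R -> T -> R;
   only the values at t >= 0 are ever used. *)

Definition centered_normal_law {R : realType} (v : R) : set R -> \bar R :=
  if v == 0 then (fun A => (\1_A (0:R))%:E) else normal_prob 0 (Num.sqrt v).

Definition is_centered_normal {R : realType} (d : measure_display)
    (T : measurableType d) (P : probability T R) (Y : T -> R) (v : R) :=
  0 <= v /\ forall B : set R, measurable B ->
    P (Y @^-1` B) = centered_normal_law v B.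

Definition centered_gaussian_process {R : realType} (d : measure_display)
    (T : measurableType d) (P : probability T R) (X : R -> T -> R) :=
  (forall t, 0 <= t -> measurable_fun setT (X t)) /\
  forall (n : nat) (a : 'I_n -> R) (ts : 'I_n -> R), (forall i, 0 <= ts i) ->
    exists v : R, is_centered_normal P (fun w => \sum_(i < n) a i * X (ts i) w) v.

Definition same_law {R : realType} (d : measure_display) (T : measurableType d)
    (P : probability T R) (X : R -> T -> R)
    (d' : measure_display) (T' : measurableType d')
    (P' : probability T' R) (Y : R -> T' -> R) :=
  forall (n : nat) (ts : 'I_n -> R) (B : 'I_n -> set R),
    (forall i, 0 <= ts i) -> (forall i, measurable (B i)) ->
    P (\bigcap_(i in [set: 'I_n]) (X (ts i) @^-1` B i)) =
    P' (\bigcap_(i in [set: 'I_n]) (Y (ts i) @^-1` B i)).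

Definition stoch_continuous_at0 {R : realType} (d : measure_display)
    (T : measurableType d) (P : probability T R) (X : R -> T -> R) :=
  forall eps : R, 0 < eps ->
    (fun t : R => P [set w | eps < `|X t w - X 0 w|]) @ at_right (0:R) --> 0%E.

Definition self_similar {R : realType} (d : measure_display)
    (T : measurableType d) (P : probability T R) (X : R -> T -> R) (H : R) :=
  stoch_continuous_at0 P X /\
  forall a : R, 0 < a ->
    same_law P (fun t => X (a * t)) P (fun t w => a `^ H * X t w).

Definition nat_filtration {R : realType} (T : Type) (X : R -> T -> R) (t : R)
  : set (set T) :=
  <<s [set A | exists s : R, exists B : set R,
        [/\ 0 <= s, s <= t, measurable B & A = X s @^-1` B]] >>.

(* Markov property w.r.t. the natural filtration: for 0 <= t <= u and Borel B,
   P(X_u in B | F_t) is (a version of) a measurable function of X_t. *)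
Definition markov_process {R : realType} (d : measure_display)
    (T : measurableType d) (P : probability T R) (X : R -> T -> R) :=
  forall t u : R, 0 <= t -> t <= u -> forall B : set R, measurable B ->
    exists phi : R -> R,
      [/\ measurable_fun setT phi, (forall x, 0 <= phi x <= 1) &
        forall A, nat_filtration X t A ->
          P (A `&` X u @^-1` B) = (\int[P]_(w in A) (phi (X t w))%:E)%E].

Definition cov_fun {R : realType} (d : measure_display) (T : measurableType d)
    (P : probability T R) (X : R -> T -> R) (s t : R) : R :=
  fine ('E_P[(fun w => X s w * X t w)%R])%E.

(* R_{H,c}, for c in \bar R (only c <= -H is relevant; c = +oo gives 0). *)
Definition RHc {R : realType} (H : R) (c : \bar R) (s t : R) : R :=
  match c with
  | EFin c => if 0 < Num.min s t
              then (Num.max s t) `^ (2 * H + c) * (Num.min s t) `^ (- c)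
              else 0
  | -oo%E => if s == t then t `^ (2 * H) else 0
  | +oo%E => 0
  end.

(* Main.v *)
(* Let [U] be the residual of the regression of [X_s] on [X_t], [s <= t <= u].
   It is uncorrelated with [X_t], so [(U, X_t)] and [(-U, X_t)] have the same
   law, and by the Markov property so do [(U, X_u)] and [(-U, X_u)]. Hence
   [E[U X_u] = 0], that is [R(s,u) R(t,t) = R(s,t) R(t,u)]. With the scaling
   [R(as,at) = a^(2H) R(s,t)], the function [r(x) = R(x,1) / R(1,1)] is
   multiplicative on (0,1], and [|r(x)| <= x^H] by Cauchy-Schwarz; so [r] is
   either the indicator of 1 (c = -oo) or a power [x^(-c)] with [-c >= H].
   Equality of Gaussian joint laws with equal covariances follows from a
   uniqueness theorem for expectations of [cos(a_1 x_1 + .. + a_n x_n + th)]. *)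
Require Import Defs.
From HB Require Import structures.
From mathcomp Require Import all_boot all_order all_algebra.
From mathcomp Require Import all_classical all_reals all_analysis.
From mathcomp Require Import measurable_realfun.
From mathcomp Require Import ring lra.
Set Implicit Arguments. Unset Strict Implicit. Unset Printing Implicit Defensive.
Import Order.TTheory GRing.Theory Num.Theory.
Import numFieldNormedType.Exports.
Local Open Scope classical_set_scope.
Local Open Scope ring_scope.

(** * Bounded Borel functions *)

(** The Markov property yields conditional probabilities of Borel events of [X u] through a kernel
    [phi] that is merely Borel. The regression identity is therefore obtained by comparing laws of
    pairs, and second moments return only at the end, through truncation. No characteristic function
    of a Gaussian law is computed. Centered normal variables with the same parameter have the same
    law by definition, and the parameter is recovered from the second moment, which is the parameter
    times a fixed constant, positive and finite, whose value never matters. The passage from linear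
    combinations to joint laws works on weighted cosine expectations, one coordinate at a time; the
    weight absorbs the other coordinates. In the functional equation regularity comes from order
    alone: squares give nonnegativity, and the Cauchy-Schwarz bound then gives monotonicity. *)

Section bounded_measurable.
Context {R : realType}.
Import HBNNSimple.

Definition bdd_meas (g : R -> R) :=
  measurable_fun setT g /\ exists M, forall x, `|g x| <= M.

Lemma bdd_meas_indic (B : set R) : measurable B -> bdd_meas \1_B.
Proof.
move=> mB; split; first exact: measurable_indic.
by exists 1 => x; rewrite indicE ger0_norm //; case: (_ \in _).
Qed.

Lemma bdd_meas_cst (c : R) : bdd_meas (cst c).
Proof. by split; [exact: measurable_cst | exists `|c|]. Qed.

Lemma bdd_measD (f g : R -> R) :
  bdd_meas f -> bdd_meas g -> bdd_meas (fun x => f x + g x).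
Proof.
move=> [mf [M fM]] [mg [N gN]]; split; first exact: measurable_funD.
by exists (M + N) => x; rewrite (le_trans (ler_normD _ _))// lerD.
Qed.

Lemma bdd_measM (f g : R -> R) :
  bdd_meas f -> bdd_meas g -> bdd_meas (fun x => f x * g x).
Proof.
move=> [mf [M fM]] [mg [N gN]]; split; first exact: measurable_funM.
by exists (M * N) => x; rewrite normrM ler_pM.
Qed.

Lemma bdd_meas_lim (M : R) (f_ : nat -> R -> R) (f : R -> R) :
  (forall n, bdd_meas (f_ n)) -> (forall n x, `|f_ n x| <= M) ->
  (forall x, f_ n x @[n --> \oo] --> f x) -> bdd_meas f.
Proof.
move=> bf fM cf; split.
  apply: (@measurable_fun_cvg _ _ _ _ f_) => [n|x _]; last exact: cf.
  exact: (bf n).1.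
exists M => x; have cn : `|f_ n x| @[n --> \oo] --> `|f x| by exact: cvg_norm.
rewrite -(cvg_lim _ cn)//; apply: limr_le; first by apply/cvg_ex; exists `|f x|.
by apply: nearW => n; exact: fM.
Qed.

Lemma bdd_meas_sin (b c : R) : bdd_meas (fun x => sin (b * x + c)).
Proof.
split; last by exists 1 => x; exact: sin_max.
apply: continuous_measurable_fun => x.
apply: (@continuous_comp _ _ _ (fun x => b * x + c) sin).
  by apply: cvgD; [apply: cvgM; [exact: cvg_cst|exact: cvg_id]|exact: cvg_cst].
exact: continuous_sin.
Qed.

(** Functional induction on bounded Borel functions. Adding the bound makes [f] nonnegative; its
    increasing simple approximations then stay between 0 and a fixed bound, so the clause on bounded
    limits applies. *)
Lemma bdd_meas_ind (D : (R -> R) -> Prop) :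
  (forall B : set R, measurable B -> D \1_B) ->
  (forall (a : R) f g, D f -> D g -> D (fun x => a * f x + g x)) ->
  (forall (M : R) (f_ : nat -> R -> R) f, (forall n, D (f_ n)) ->
     (forall n x, `|f_ n x| <= M) ->
     (forall x, f_ n x @[n --> \oo] --> f x) -> D f) ->
  forall f, bdd_meas f -> D f.
Proof.
move=> D1 Dlin Dlim.
have D0 : D (fun=> 0) by have := D1 set0 measurable0; rewrite indic0.
have Dcst a : D (fun=> a).
  have -> : (fun=> a : R) = (fun x : R => a * \1_setT x + 0).
    by apply/funext => x; rewrite indicT mulr1 addr0.
  by apply: Dlin => //; exact: D1.
suff Dpos (f : R -> R) (M : R) : measurable_fun setT f -> (forall x, 0 <= f x <= M) -> D f.
  move=> f [mf [M fM]].
  have -> : f = (fun x => 1 * (f x + M) + - M).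
    by apply/funext => x; rewrite mul1r addrK.
  apply: Dlin; last exact: Dcst.
  apply: (Dpos _ (M + M)); first exact: measurable_funD.
  by move=> x; have := fM x; rewrite ler_norml; lra.
move=> mf fM.
have mf' : measurable_fun setT (EFin \o f) by exact/measurable_EFinP.
have f0 x : [set: R] x -> (0 <= (EFin \o f) x)%E.
  by rewrite lee_fin; have /andP[] := fM x.
pose f_ n : R -> R := nnsfun_approx measurableT mf' n.
apply: (Dlim M f_) => [n|n x|x].
- have -> : f_ n = fun x => \sum_(y <- finmap.enum_fset (fset_set (range (f_ n))))
      y * \1_(f_ n @^-1` [set y]) x.
    apply/funext => x; rewrite {1}/f_ fimfunE fsbig_finite //=.
  elim: (finmap.enum_fset _) => [|y s IH].
    by under eq_fun do rewrite big_nil.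
  under eq_fun do rewrite big_cons.
  apply: Dlin => //; apply: D1.
  exact: (measurable_funPTI (nnsfun_approx measurableT mf' n)).
- rewrite /f_ ger0_norm ?nnsfun_approxE //; last first.
    by rewrite -nnsfun_approxE; exact: fun_ge0.
  have := le_approx n f0 (I : [set: R] x).
  by rewrite lee_fin => /le_trans; apply; have /andP[] := fM x.
- have := @cvg_approx _ _ _ _ (EFin \o f) x f0 I (ltry _).
  rewrite /=; under eq_fun do rewrite -(nnsfun_approxE measurableT mf').
  exact.
Qed.

End bounded_measurable.

(** * Trigonometric expectations determine joint laws *)

Section expectation.
Context {R : realType} (d : measure_display) (T : measurableType d)
  (P : probability T R).

Lemma Rintegral_cvg (f_ : nat -> T -> R) (f g : T -> R) :
  (forall n, measurable_fun setT (f_ n)) ->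
  (forall x, f_ n x @[n --> \oo] --> f x) ->
  P.-integrable setT (EFin \o g) -> (forall n x, `|f_ n x| <= g x) ->
  P.-integrable setT (EFin \o f) /\
  (\int[P]_x f_ n x) @[n --> \oo] --> \int[P]_x f x.
Proof.
move=> mf cf ig fg.
have mlim : measurable_fun setT f by apply: (@measurable_fun_cvg _ _ _ _ f_) => // x _.
have [||||/= i_f _ cif] := @dominated_convergence _ _ _ P setT measurableT
   (fun n => EFin \o f_ n) (EFin \o f) (EFin \o g) _ _ _ ig.
- by move=> n; exact/measurable_EFinP.
- exact/measurable_EFinP.
- by apply: aeW => x _; apply/cvg_EFin => //; [exact: nearW|exact: cf].
- by apply: aeW => x n _; rewrite lee_fin.
split => //; apply: fine_cvg; rewrite fineK //.
exact: integrable_fin_num.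
Qed.

Lemma integrable_bdd (f : T -> R) (M : R) :
  measurable_fun setT f -> (forall x, `|f x| <= M) ->
  P.-integrable setT (EFin \o f).
Proof.
move=> mf fM; apply: measurable_bounded_integrable => //.
  exact: le_lt_trans (probability_le1 P measurableT) (ltry 1).
by exists M; split; [exact: num_real | move=> N MN x _; exact: le_trans (fM x) (ltW MN)].
Qed.

Lemma integrableM_bdd (K f : T -> R) (M : R) :
  P.-integrable setT (EFin \o K) ->
  measurable_fun setT f -> (forall x, `|f x| <= M) ->
  P.-integrable setT (EFin \o (fun x => K x * f x)).
Proof.
move=> iK mf fM; apply: (integrableMl measurableT iK mf).
by exists M; split; [exact: num_real | move=> N MN x _; exact: le_trans (fM x) (ltW MN)].
Qed.

Lemma integrableM_bdd_meas (K Z : T -> R) (f : R -> R) :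
  P.-integrable setT (EFin \o K) -> measurable_fun setT Z -> bdd_meas f ->
  P.-integrable setT (EFin \o (fun x => K x * f (Z x))).
Proof.
move=> iK mZ [mf [M fM]]; apply: (@integrableM_bdd _ (f \o Z) M iK).
  exact: measurableT_comp.
by move=> x; exact: fM.
Qed.

Lemma Rintegral_lin (a : R) (f g : T -> R) :
  P.-integrable setT (EFin \o f) -> P.-integrable setT (EFin \o g) ->
  \int[P]_x (a * f x + g x) = a * (\int[P]_x f x) + \int[P]_x g x.
Proof.
move=> i_f i_g; rewrite RintegralD // ?RintegralZl //.
exact: (integrableZl measurableT a i_f).
Qed.

Lemma Rintegral_cvg_bdd_meas (K Z : T -> R) (M : R) (f_ : nat -> R -> R)
    (f : R -> R) :
  P.-integrable setT (EFin \o K) -> measurable_fun setT Z ->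
  (forall n, bdd_meas (f_ n)) -> (forall n x, `|f_ n x| <= M) ->
  (forall x, f_ n x @[n --> \oo] --> f x) ->
  (\int[P]_x (K x * f_ n (Z x))) @[n --> \oo] --> \int[P]_x (K x * f (Z x)).
Proof.
move=> iK mZ bf fM cf.
have iKM : P.-integrable setT (EFin \o (fun x => `|K x| * M)).
  apply: (@integrableM_bdd (fun x => `|K x|) (cst M) `|M|) => //.
  exact: integrable_norm.
apply: (proj2 (Rintegral_cvg _ _ iKM _)) => [n|x|n x].
- by apply/measurable_EFinP/(measurable_int P); exact: integrableM_bdd_meas.
- by apply: cvgM; [exact: cvg_cst|exact: cf].
- by rewrite normrM ler_wpM2l.
Qed.

End expectation.

Section two_spaces.
Context {R : realType} (d : measure_display) (T : measurableType d)
  (P : probability T R) (d' : measure_display) (T' : measurableType d')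
  (P' : probability T' R).

Lemma Rintegral_bdd_meas_eq (K Z : T -> R) (K' Z' : T' -> R) :
  P.-integrable setT (EFin \o K) -> P'.-integrable setT (EFin \o K') ->
  measurable_fun setT Z -> measurable_fun setT Z' ->
  (forall B : set R, measurable B ->
     \int[P]_x (K x * \1_B (Z x)) = \int[P']_x (K' x * \1_B (Z' x))) ->
  forall f, bdd_meas f ->
    \int[P]_x (K x * f (Z x)) = \int[P']_x (K' x * f (Z' x)).
Proof.
move=> iK iK' mZ mZ' H f bf.
(* Boundedness is carried through the induction, because linearity of the integral and dominated
   convergence both need it. *)
suff [] : bdd_meas f /\
    \int[P]_x (K x * f (Z x)) = \int[P']_x (K' x * f (Z' x)) by [].
move: f bf; apply: bdd_meas_ind.
- by move=> B mB; split; [exact: bdd_meas_indic | exact: H].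
- move=> a f g [bf Ef] [bg Eg]; split.
    by apply: bdd_measD => //; apply: bdd_measM => //; exact: bdd_meas_cst.
  under eq_Rintegral do rewrite mulrDr mulrCA.
  rewrite Rintegral_lin; [|exact: integrableM_bdd_meas..].
  under [RHS]eq_Rintegral do rewrite mulrDr mulrCA.
  by rewrite Rintegral_lin ?Ef ?Eg //; exact: integrableM_bdd_meas.
- move=> M f_ f bE fM cf; have bf n := (bE n).1; split.
    exact: (bdd_meas_lim bf fM cf).
  have c1 := Rintegral_cvg_bdd_meas iK mZ bf fM cf.
  have c2 := Rintegral_cvg_bdd_meas iK' mZ' bf fM cf.
  move: c1; under eq_fun do rewrite (bE _).2.
  by move=> c1; apply: (cvg_unique _ c1 c2).
Qed.

Context (Z : T -> R) (Z' : T' -> R).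
Hypothesis mZ : measurable_fun setT Z.
Hypothesis mZ' : measurable_fun setT Z'.

(** Equality of the Fourier transforms of [Z] and [Z'] under the signed measures with densities [K]
    and [K']. The free phase [th] lets real cosines do the work of complex exponentials. *)
Definition trig_eq (K : T -> R) (K' : T' -> R) :=
  [/\ P.-integrable setT (EFin \o K), P'.-integrable setT (EFin \o K') &
    forall a th : R, \int[P]_x (K x * cos (a * Z x + th)) =
                     \int[P']_x (K' x * cos (a * Z' x + th))].

(* The multipliers form an algebra closed under bounded pointwise limits and
   containing the trigonometric polynomials, hence all bounded Borel functions:
   this replaces the inversion formula for characteristic functions. *)
Definition trig_multiplier (g : R -> R) := bdd_meas g /\
  forall K K', trig_eq K K' ->
    trig_eq (fun x => K x * g (Z x)) (fun x => K' x * g (Z' x)).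

Let bdd_cos (a th : R) : bdd_meas (fun x => cos (a * x + th)).
Proof.
rewrite (_ : (fun _ => _) = (fun x => sin (a * x + (th + pi / 2)))).
  exact: bdd_meas_sin.
by apply/funext => x; rewrite addrA sinDpihalf.
Qed.

Lemma trig_multiplier_cst (c : R) : trig_multiplier (cst c).
Proof.
split; first exact: bdd_meas_cst.
move=> K K' [iK iK' E]; split.
- exact: (integrableM_bdd_meas iK mZ (bdd_meas_cst c)).
- exact: (integrableM_bdd_meas iK' mZ' (bdd_meas_cst c)).
move=> a th.
under eq_Rintegral do rewrite mulrAC.
rewrite RintegralZr //; last exact: (integrableM_bdd_meas iK mZ (bdd_cos a th)).
under [RHS]eq_Rintegral do rewrite mulrAC.
rewrite RintegralZr //; last exact: (integrableM_bdd_meas iK' mZ' (bdd_cos a th)).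
by rewrite E.
Qed.

(** Multipliers act on all weights, so a product of multipliers is a composition. *)
Lemma trig_multiplierM (f g : R -> R) :
  trig_multiplier f -> trig_multiplier g -> trig_multiplier (fun x => f x * g x).
Proof.
move=> [bf mf] [bg mg]; split; first exact: bdd_measM.
move=> K K' /mf /mg.
by under eq_fun do rewrite -mulrA; under [X in trig_eq _ X]eq_fun do rewrite -mulrA.
Qed.

Lemma trig_eqD (K L : T -> R) (K' L' : T' -> R) : trig_eq K K' -> trig_eq L L' ->
  trig_eq (fun x => K x + L x) (fun x => K' x + L' x).
Proof.
move=> [iK iK' E] [iL iL' F]; split.
- exact: (integrableD measurableT iK iL).
- exact: (integrableD measurableT iK' iL').
move=> a th.
under eq_Rintegral do rewrite mulrDl.
under [RHS]eq_Rintegral do rewrite mulrDl.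
by rewrite !RintegralD ?E ?F //;
  [exact: (integrableM_bdd_meas iK' mZ' (bdd_cos a th))
  |exact: (integrableM_bdd_meas iL' mZ' (bdd_cos a th))
  |exact: (integrableM_bdd_meas iK mZ (bdd_cos a th))
  |exact: (integrableM_bdd_meas iL mZ (bdd_cos a th))].
Qed.

Lemma trig_multiplierD (f g : R -> R) :
  trig_multiplier f -> trig_multiplier g -> trig_multiplier (fun x => f x + g x).
Proof.
move=> [bf mf] [bg mg]; split; first exact: bdd_measD.
move=> K K' e; have := trig_eqD (mf _ _ e) (mg _ _ e).
by under eq_fun do rewrite -mulrDr; under [X in trig_eq _ X]eq_fun do rewrite -mulrDr.
Qed.

Lemma trig_multiplier_lim (M : R) (f_ : nat -> R -> R) (f : R -> R) :
  (forall n, trig_multiplier (f_ n)) -> (forall n x, `|f_ n x| <= M) ->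
  (forall x, f_ n x @[n --> \oo] --> f x) -> trig_multiplier f.
Proof.
move=> tf fM cf; have bf n := (tf n).1.
have blim := bdd_meas_lim bf fM cf.
split => // K K' e; have [iK iK' _] := e; split.
- exact: integrableM_bdd_meas.
- exact: integrableM_bdd_meas.
move=> a th.
pose c x := cos (a * x + th) : R.
have cM n x : `|f_ n x * c x| <= M.
  rewrite normrM -[leRHS]mulr1.
  by apply: ler_pM => //; exact: cos_max.
have cc x : f_ n x * c x @[n --> \oo] --> f x * c x.
  by apply: cvgM; [exact: cf|exact: cvg_cst].
have bc n : bdd_meas (fun x => f_ n x * c x).
  exact: (bdd_measM (bf n) (bdd_cos a th)).
have c1 := Rintegral_cvg_bdd_meas iK mZ bc cM cc.
have c2 := Rintegral_cvg_bdd_meas iK' mZ' bc cM cc.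
have E n : \int[P]_x (K x * (f_ n (Z x) * c (Z x))) =
           \int[P']_x (K' x * (f_ n (Z' x) * c (Z' x))).
  have [_ _ /(_ a th)] := (tf n).2 _ _ e.
  under eq_Rintegral do rewrite -mulrA.
  by under [RHS]eq_Rintegral do rewrite -mulrA.
move: c1; under eq_fun do rewrite E.
move=> c1.
under eq_Rintegral do rewrite -mulrA.
under [RHS]eq_Rintegral do rewrite -mulrA.
exact: (cvg_unique _ c1 c2).
Qed.

Lemma sin_cos_sum (x y : R) :
  sin x * cos y = 2^-1 * cos (x + y - pi / 2) + 2^-1 * cos (x - y - pi / 2).
Proof. by rewrite !cosBpihalf sinD sinB; field. Qed.

(** This sine times a cosine of frequency [a] is a combination of cosines of frequencies [b + a] and
    [b - a] with new phases, to which the hypothesis on the weights applies. *)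
Lemma trig_multiplier_sin (b c : R) : trig_multiplier (fun x => sin (b * x + c)).
Proof.
split; first exact: bdd_meas_sin.
move=> K K' [iK iK' E]; split.
- exact: (integrableM_bdd_meas iK mZ (bdd_meas_sin b c)).
- exact: (integrableM_bdd_meas iK' mZ' (bdd_meas_sin b c)).
move=> a th.
have key k z : k * sin (b * z + c) * cos (a * z + th) =
  2^-1 * (k * cos ((b + a) * z + (c + th - pi / 2))) +
  2^-1 * (k * cos ((b - a) * z + (c - th - pi / 2))).
  rewrite -mulrA sin_cos_sum mulrDr !(mulrCA k).
  by congr (_ * (_ * cos _) + _ * (_ * cos _)); ring.
have split_int (d0 : measure_display) (T0 : measurableType d0) (Q : probability T0 R)
    (k z : T0 -> R) : Q.-integrable setT (EFin \o k) -> measurable_fun setT z ->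
  \int[Q]_x (k x * sin (b * z x + c) * cos (a * z x + th)) =
  2^-1 * (\int[Q]_x (k x * cos ((b + a) * z x + (c + th - pi / 2)))) +
  2^-1 * (\int[Q]_x (k x * cos ((b - a) * z x + (c - th - pi / 2)))).
  move=> ik mz; under eq_Rintegral do rewrite key.
  have i1 := integrableM_bdd_meas ik mz (bdd_cos (b + a) (c + th - pi / 2)).
  have i2 := integrableM_bdd_meas ik mz (bdd_cos (b - a) (c - th - pi / 2)).
  rewrite Rintegral_lin //; last exact: (integrableZl measurableT _ i2).
  by rewrite RintegralZl.
by rewrite !split_int // !E.
Qed.

End two_spaces.

(** * Polynomials converging to a step function on [0,1] *)

Section step_polynomials.
Context {R : realType}.

Lemma bernoulli_ge (y : R) n : -1 <= y -> 1 + n%:R * y <= (1 + y) ^+ n.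
Proof.
move=> y1; elim: n => [|n IH]; first by rewrite mul0r addr0 expr0.
rewrite exprS; have h : 0 <= 1 + y by lra.
apply: le_trans (ler_wpM2l h IH).
rewrite -natr1; have : 0 <= n%:R * y ^+ 2 by rewrite mulr_ge0 // sqr_ge0.
nra.
Qed.

(** Multiplying by [(1 + y) ^+ n], which is at least [1 + n%:R * y], gives
    [(1 - y ^+ 2) ^+ n <= 1]. *)
Lemma bernoulli_le (y : R) n : 0 <= y <= 1 -> (1 - y) ^+ n <= (1 + n%:R * y)^-1.
Proof.
move=> /andP[y0 y1].
have p : 0 < 1 + n%:R * y by rewrite ltr_pwDl // mulr_ge0.
rewrite -[leRHS]mul1r ler_pdivlMr //.
apply: (@le_trans _ _ ((1 - y) ^+ n * (1 + y) ^+ n)).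
  by rewrite ler_wpM2l ?exprn_ge0 ?subr_ge0 //; apply: bernoulli_ge; lra.
by rewrite -exprMn exprn_ile1 //; nra.
Qed.

(** With [s] the square root of [r], Bernoulli's inequality for [s^-1 = 1 + h] bounds
    [n%:R * s ^+ n] by [h^-1]; the remaining factor [s ^+ n] tends to 0. *)
Lemma cvg_natM_expr (r : R) : 0 <= r < 1 -> (n%:R * r ^+ n : R) @[n --> \oo] --> (0:R).
Proof.
move=> /andP[]; rewrite le_eqVlt => /predU1P[<- _|r0 r1].
  apply: cvg_near_cst; exists 1%N => // n /= n0.
  by rewrite expr0n; case: n n0 => //= n _; rewrite mulr0.
pose s := Num.sqrt r.
have s0 : 0 < s by rewrite sqrtr_gt0.
have rs : r = s ^+ 2 by rewrite sqr_sqrtr // ltW.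
have s1 : s < 1 by rewrite -(@ltr_pXn2r _ 2) ?nnegrE ?ltW // expr1n -rs.
pose h := s^-1 - 1.
have h0 : 0 < h by rewrite subr_gt0 invf_gt1.
have B n : n%:R * s ^+ n <= h^-1.
  have h1 : 1 + h = s^-1 by rewrite /h addrC subrK.
  have := @bernoulli_ge h n ltac:(lra).
  rewrite h1 exprVn => nb.
  rewrite -[leRHS]mul1r ler_pdivlMr // mulrAC -ler_pdivlMr ?exprn_gt0 // mul1r.
  lra.
apply: (@squeeze_cvgr _ _ _ _ (fun=> 0) (fun n => h^-1 * s ^+ n)).
- apply: nearW => n; rewrite mulr_ge0 ?exprn_ge0 ?(ltW r0) //=.
  rewrite rs -exprM mulnC mulnS muln1 exprD mulrA ler_wpM2r ?exprn_ge0 ?(ltW s0) //.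
- exact: cvg_cst.
- rewrite -(mulr0 h^-1); apply: cvgM; first exact: cvg_cst.
  by apply: cvg_expr; rewrite ger0_norm // ltW.
Qed.

(* The factor [n] in the exponent makes the limit at the threshold [u = 2^-1] equal to 0 rather than [expR (-1)]. *)
Definition step_poly (n : nat) (u : R) : R := (1 - u ^+ n) ^+ (n * 2 ^ n).

Lemma step_poly_bound (n : nat) (u : R) : 0 <= u <= 1 -> 0 <= step_poly n u <= 1.
Proof.
move=> /andP[u0 u1].
have /andP[] : 0 <= u ^+ n <= 1 by rewrite exprn_ge0 // exprn_ile1.
by move=> v0 v1; rewrite /step_poly exprn_ge0 ?exprn_ile1 //; lra.
Qed.

(** The device of elementary proofs of the Stone-Weierstrass theorem: exponent times inner power is
    [n%:R * (2 * u) ^+ n]. It tends to 0 below the threshold and is at least [n] from the threshold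
    on; the two Bernoulli bounds turn this into the limits 1 and 0. *)
Lemma cvg_step_poly (u : R) : 0 <= u <= 1 ->
  step_poly n u @[n --> \oo] --> ((u < 2^-1)%R%:R : R).
Proof.
move=> u01; have /andP[u0 u1] := u01.
have un n : 0 <= u ^+ n <= 1 by rewrite exprn_ge0 // exprn_ile1.
have E n : (n * 2 ^ n)%:R * u ^+ n = n%:R * (2 * u) ^+ n.
  by rewrite natrM natrX exprMn mulrA.
case: ltP => u2 /=.
  apply: (@squeeze_cvgr _ _ _ _ (fun n => 1 - n%:R * (2 * u) ^+ n) (fun=> 1)).
  - apply: nearW => n; have /andP[_ ->] := step_poly_bound n u01; rewrite andbT.
    rewrite -E -mulrN; apply: bernoulli_ge.
    by have /andP[] := un n; lra.
  - rewrite -[X in _ --> X]subr0; apply: cvgB; first exact: cvg_cst.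
    by apply: cvg_natM_expr; lra.
  - exact: cvg_cst.
apply: (@squeeze_cvgr _ _ _ _ (fun=> 0) (fun n => n.+1%:R^-1)).
- apply: nearW => n; have /andP[-> _] := step_poly_bound n u01 => /=.
  apply: le_trans (bernoulli_le _ (un n)) _.
  rewrite E lef_pV2 ?posrE ?ltr0n //; last first.
    by rewrite ltr_pwDl // mulr_ge0 // exprn_ge0 // mulr_ge0.
  rewrite -nat1r lerD2l ler_peMr // exprn_ege1 //; lra.
- exact: cvg_cst.
- exact: cvg_harmonic.
Qed.

End step_polynomials.

(** * Borel indicators are multipliers *)

Section trig_multiplier_bdd_meas.
Context {R : realType} (d : measure_display) (T : measurableType d)
  (P : probability T R) (d' : measure_display) (T' : measurableType d')
  (P' : probability T' R) (Z : T -> R) (Z' : T' -> R).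
Hypothesis mZ : measurable_fun setT Z.
Hypothesis mZ' : measurable_fun setT Z'.
Local Notation mult := (trig_multiplier P P' Z Z').

Lemma trig_multiplierX (f : R -> R) n : mult f -> mult (fun x => f x ^+ n).
Proof.
move=> mf; elim: n => [|n IH]; first exact: (trig_multiplier_cst P P' mZ mZ' 1).
under eq_fun do rewrite exprS.
exact: trig_multiplierM.
Qed.

Lemma trig_multiplier_onem (f : R -> R) : mult f -> mult (fun x => 1 - f x).
Proof.
move=> mf; have c1 := trig_multiplier_cst P P' mZ mZ' 1.
have cN1 := trig_multiplier_cst P P' mZ mZ' (-1).
have := trig_multiplierD mZ mZ' c1 (trig_multiplierM cN1 mf).
by congr mult; apply/funext => x /=; rewrite mulN1r.
Qed.

Lemma trig_multiplier_prod (f : nat -> R -> R) n :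
  (forall k, mult (f k)) -> mult (fun x => \prod_(k < n) f k x).
Proof.
move=> mf; elim: n => [|n IH].
  under eq_fun do rewrite big_ord0.
  exact: (trig_multiplier_cst P P' mZ mZ' 1).
under eq_fun do rewrite big_ord_recr.
exact: trig_multiplierM.
Qed.

Lemma trig_multiplier_halfline (b : R) : mult \1_(`]-oo, b[%classic).
Proof.
(* The sine is rescaled to [0,1] so that [u a x < 2^-1] means that [sin (a * (x - b))] is negative;
   the step polynomials then produce the indicator of that event. *)
pose u (a x : R) := (1 + sin (a * x + - (a * b))) * 2^-1.
have u01 a x : 0 <= u a x <= 1.
  by rewrite /u; have := sin_geN1 (a * x + - (a * b));
     have := sin_le1 (a * x + - (a * b)); lra.
have mu a : mult (u a).
  apply: trig_multiplierM; last exact: trig_multiplier_cst.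
  apply: trig_multiplierD => //; first exact: trig_multiplier_cst.
  exact: trig_multiplier_sin.
have ms a : mult (fun x => (u a x < 2^-1)%R%:R).
  apply: (@trig_multiplier_lim _ _ _ _ _ _ _ _ _ mZ mZ' 1
            (fun n x => step_poly n (u a x))).
  - move=> n; apply: trig_multiplierX; apply: trig_multiplier_onem.
    exact: trig_multiplierX.
  - move=> n x; have /andP[s0 s1] := step_poly_bound n (u01 a x).
    by rewrite ger0_norm.
  - by move=> x; exact: cvg_step_poly.
(* Letting the frequency tend to 0 removes periodicity: once [a * |x - b| < pi], the sine has the
   sign of [x - b], so the sequence is eventually constant at each point. *)
apply: (@trig_multiplier_lim _ _ _ _ _ _ _ _ _ mZ mZ' 1
            (fun n x => (u n.+1%:R^-1 x < 2^-1)%R%:R)) => //.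
- by move=> n x; rewrite ger0_norm //; case: (_ < _).
- move=> x; apply: cvg_near_cst.
  have : \forall n \near \oo, `|x - b| * n.+1%:R^-1 < pi.
    have c : `|x - b| * n.+1%:R^-1 @[n --> \oo] --> (0 : R).
      by rewrite -(mulr0 `|x - b|); apply: cvgM; [exact: cvg_cst|exact: cvg_harmonic].
    by apply: (cvgr_lt _ c); exact: pi_gt0.
  apply: filterS => n hn.
  rewrite indicE mem_setE in_itv /= /u -mulrN -mulrDr.
  have n0 : 0 < (n.+1%:R^-1 : R) by rewrite invr_gt0.
  have half (s : R) : ((1 + s) * 2^-1 < 2^-1) = (s < 0) by apply/idP/idP; lra.
  rewrite half; move: hn; rewrite mulrC => hn.
  suff -> : (sin (n.+1%:R^-1 * (x - b)) < 0) = (x < b) by [].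
  move: hn.
  case: (ltgtP x b) => [xb|bx|->]; last by rewrite subrr mulr0 sin0 ltxx.
  + rewrite ltr0_norm ?subr_lt0 // => ypi.
    rewrite -[_ * _]opprK -mulrN sinN oppr_lt0.
    by rewrite sin_gt0_pi // ypi mulr_gt0 // oppr_gt0 subr_lt0.
  + rewrite gtr0_norm ?subr_gt0 // => ypi.
    by apply/negbTE; rewrite -leNgt ltW // sin_gt0_pi // ypi mulr_gt0 // subr_gt0.
Qed.

(** The sets whose indicator is a multiplier form a sigma-algebra containing the open left
    half-lines. Closure under products handles unions that are not disjoint, so no Dynkin argument
    intervenes. *)
Lemma trig_multiplier_indic (B : set R) : measurable B -> mult \1_B.
Proof.
suff h : @measurable _ R `<=` [set B | mult \1_B] by exact: h.
rewrite [X in X `<=` _](RGenInftyO.measurableE R).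
apply: smallest_sub; last by move=> _ [b ->]; exact: trig_multiplier_halfline.
split => /=.
- rewrite (_ : \1_set0 = (fun=> 0 : R)).
    exact: (trig_multiplier_cst P P' mZ mZ' 0).
  by apply/funext => x; rewrite indicE in_set0.
- move=> A mA; have := trig_multiplier_onem mA.
  have -> : \1_([set: R] `\` A) = (fun x => 1 - \1_A x) :> (R -> R).
    by apply/funext => x; rewrite setTD indicC indicE;
      case: (_ \in _); rewrite /= ?subrr ?subr0.
  exact.
- move=> A mA.
  (* One minus the product of the complementary indicators is the indicator of the partial union; at
     each point it is eventually constant. *)
  apply: (@trig_multiplier_lim _ _ _ _ _ _ _ _ _ mZ mZ' 1
     (fun n x => 1 - \prod_(k < n) (1 - \1_(A k) x))).
  + move=> n; apply: trig_multiplier_onem.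
    apply: (@trig_multiplier_prod (fun k x => 1 - \1_(A k) x)) => k.
    exact: trig_multiplier_onem.
  + move=> n x.
    pose f (k : nat) : R := 1 - \1_(A k) x.
    have f01 k : 0 <= f k <= 1.
      rewrite /f indicE; case: (_ \in _); rewrite ?mulr1n ?mulr0n;
      apply/andP; split; lra.
    have p0 : 0 <= \prod_(k < n) f k.
      by apply: prodr_ge0 => k _; have /andP[] := f01 k.
    have p1 : \prod_(k < n) f k <= 1.
      by apply: prodr_ile1 => k _; exact: f01.
    by rewrite ger0_norm; lra.
  + move=> x; apply: cvg_near_cst; rewrite indicE.
    case: (boolP (x \in _)) => [/set_mem [k _ Akx]|xA].
      exists k.+1 => // n /= kn.
      by rewrite (bigD1 (Ordinal kn)) //= indicE mem_set // subrr mul0r subr0.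
    apply: nearW => n; rewrite big1 ?subrr // => k _.
    rewrite indicE memNset ?subr0 // => Akx.
    by move: xA; rewrite mem_set //; exists k.
Qed.

Lemma trig_eq_bdd_meas (K : T -> R) (K' : T' -> R) : trig_eq P P' Z Z' K K' ->
  forall f, bdd_meas f ->
    \int[P]_x (K x * f (Z x)) = \int[P']_x (K' x * f (Z' x)).
Proof.
move=> e; have [iK iK' _] := e.
apply: Rintegral_bdd_meas_eq => // B mB.
(* At zero frequency and phase the cosine is 1, and only the weighted indicator remains. *)
have [_ _ /(_ 0 0)] := (trig_multiplier_indic mB).2 _ _ e.
under eq_Rintegral do rewrite mul0r addr0 cos0 mulr1.
by under [RHS]eq_Rintegral do rewrite mul0r addr0 cos0 mulr1.
Qed.

End trig_multiplier_bdd_meas.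

(** * Joint laws and mixed moments *)

Section joint_law.
Context {R : realType} (d : measure_display) (T : measurableType d)
  (P : probability T R) (d' : measure_display) (T' : measurableType d')
  (P' : probability T' R).

Lemma cosM_half (x y : R) :
  cos x * cos y = 2^-1 * cos (x + y) + 2^-1 * cos (x - y).
Proof. by rewrite cosD cosB; field. Qed.

Lemma measurable_lin_comb (d0 : measure_display) (T0 : measurableType d0)
    (I : eqType) (x : I -> T0 -> R) (a : I -> R) (s : seq I) :
  (forall i, measurable_fun setT (x i)) ->
  measurable_fun setT (fun w => \sum_(i <- s) a i * x i w).
Proof.
move=> mx; apply: measurable_sum => i; exact: measurable_funM.
Qed.

Lemma integrableM_cos (d0 : measure_display) (T0 : measurableType d0)
    (Q : probability T0 R) (K W : T0 -> R) (th : R) :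
  Q.-integrable setT (EFin \o K) -> measurable_fun setT W ->
  Q.-integrable setT (EFin \o (fun w => K w * cos (W w + th))).
Proof.
move=> iK mW.
have := integrableM_bdd_meas iK mW (bdd_meas_sin 1 (th + pi / 2)).
by under eq_fun do rewrite mul1r addrA sinDpihalf.
Qed.

(** Induction on the coordinates: [f i (x i w)] is absorbed into the weight. The hypothesis for the
    new weight follows from the one-dimensional result in coordinate [i], where the cosine of the
    other coordinates is itself part of the weight. *)
Lemma Rintegral_prod_eq (I : eqType) (x : I -> T -> R) (y : I -> T' -> R)
    (s : seq I) (K : T -> R) (K' : T' -> R) (f : I -> R -> R) :
  (forall i, measurable_fun setT (x i)) ->
  (forall i, measurable_fun setT (y i)) -> uniq s ->
  P.-integrable setT (EFin \o K) -> P'.-integrable setT (EFin \o K') ->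
  (forall a th,
     \int[P]_w (K w * cos (\sum_(i <- s) a i * x i w + th)) =
     \int[P']_w (K' w * cos (\sum_(i <- s) a i * y i w + th))) ->
  (forall i, bdd_meas (f i)) ->
  \int[P]_w (K w * \prod_(i <- s) f i (x i w)) =
  \int[P']_w (K' w * \prod_(i <- s) f i (y i w)).
Proof.
move=> mx my + + + + bf; elim: s K K' => [|i s IH] K K' /=.
  move=> _ _ _ /(_ (fun=> 0) 0).
  under eq_Rintegral do rewrite big_nil addr0 cos0.
  under [RHS]eq_Rintegral do rewrite big_nil addr0 cos0.
  move=> E; under eq_Rintegral do rewrite big_nil.
  by under [RHS]eq_Rintegral do rewrite big_nil.
move=> /andP[i_s us] iK iK' H.
under eq_Rintegral do rewrite big_cons mulrA.
under [RHS]eq_Rintegral do rewrite big_cons mulrA.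
apply: IH => //; [exact: integrableM_bdd_meas..|].
move=> a th.
under eq_Rintegral do rewrite mulrAC.
under [RHS]eq_Rintegral do rewrite mulrAC.
apply: (@trig_eq_bdd_meas _ _ _ _ _ _ _ _ _ (mx i) (my i)) => //.
have mW := measurable_lin_comb a s mx; have mW' := measurable_lin_comb a s my.
split; [exact: integrableM_cos..|].
move=> b th'.
(* Coefficients for the longer list: [e] at [i], [a] elsewhere. This is consistent because [uniq]
   keeps [i] out of [s]. *)
pose c (e : R) j := if j == i then e else a j.
have split_int (d0 : measure_display) (T0 : measurableType d0) (Q : probability T0 R)
    (k : T0 -> R) (z : I -> T0 -> R) :
    Q.-integrable setT (EFin \o k) -> (forall i, measurable_fun setT (z i)) ->
  \int[Q]_w (k w * cos (\sum_(j <- s) a j * z j w + th) * cos (b * z i w + th')) =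
  2^-1 * (\int[Q]_w (k w * cos (\sum_(j <- i :: s) c b j * z j w + (th + th')))) +
  2^-1 * (\int[Q]_w (k w * cos (\sum_(j <- i :: s) c (- b) j * z j w + (th - th')))).
  move=> ik mz.
  have i1 e t := @integrableM_cos _ _ Q k _ t ik (measurable_lin_comb (c e) (i :: s) mz).
  rewrite -[X in _ + X]RintegralZl // -Rintegral_lin //; last first.
    exact: (integrableZl measurableT 2^-1 (i1 _ _)).
  apply: eq_Rintegral => w _; rewrite -mulrA cosM_half mulrDr !(mulrCA (k w)).
  have Ec e : \sum_(j <- i :: s) c e j * z j w = e * z i w + \sum_(j <- s) a j * z j w.
    rewrite big_cons /c eqxx; congr (_ + _); apply: eq_big_seq => j js.
    by case: eqP => // ji; rewrite ji (negbTE i_s) in js.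
  by rewrite !Ec; congr (_ * (_ * cos _) + _ * (_ * cos _)); ring.
by rewrite !split_int // !H.
Qed.

Lemma probability_eq_of_Rintegral_indic (A : set T) (A' : set T') :
  measurable A -> measurable A' ->
  \int[P]_w \1_A w = \int[P']_w \1_A' w -> P A = P' A'.
Proof.
move=> mA mA'; rewrite /Rintegral !integral_indic // !setIT => E.
by rewrite -(fineK (fin_num_measure P A mA)) E fineK // fin_num_measure.
Qed.

(** A Cramér-Wold statement: the indicator of the intersection is a product of functions of single
    coordinates. *)
Lemma joint_law_eq (n : nat) (x : 'I_n -> T -> R) (y : 'I_n -> T' -> R) :
  (forall i, measurable_fun setT (x i)) ->
  (forall i, measurable_fun setT (y i)) ->
  (forall a th,
     \int[P]_w cos (\sum_(i < n) a i * x i w + th) =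
     \int[P']_w cos (\sum_(i < n) a i * y i w + th)) ->
  forall B : 'I_n -> set R, (forall i, measurable (B i)) ->
    P (\bigcap_(i in [set: 'I_n]) (x i @^-1` B i)) =
    P' (\bigcap_(i in [set: 'I_n]) (y i @^-1` B i)).
Proof.
move=> mx my H B mB.
have mcap (d0 : measure_display) (T0 : measurableType d0) (z : 'I_n -> T0 -> R) :
    (forall i, measurable_fun setT (z i)) ->
    measurable (\bigcap_(i in [set: 'I_n]) (z i @^-1` B i)).
  move=> mz; apply: fin_bigcap_measurable => // i _.
  by rewrite -[X in measurable X]setTI; exact: mz.
have Ecap (d0 : measure_display) (T0 : measurableType d0) (z : 'I_n -> T0 -> R) w :
    \1_(\bigcap_(i in [set: 'I_n]) (z i @^-1` B i)) w =
    1 * \prod_(i <- index_enum 'I_n) \1_(B i) (z i w) :> R.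
  rewrite mul1r indicE; case: (boolP (w \in _)) => [/set_mem h|h].
    by rewrite big1 // => i _; rewrite indicE mem_set //; exact: h.
  have [i hi] : exists i, ~ B i (z i w).
    apply/existsNP => all_in; move/negP: h; apply.
    by apply/mem_set => i _; exact: all_in.
  by rewrite (bigD1 i) //= indicE memNset // mul0r.
apply: probability_eq_of_Rintegral_indic; [exact: mcap..|].
under eq_Rintegral do rewrite Ecap.
under [RHS]eq_Rintegral do rewrite Ecap.
apply: (@Rintegral_prod_eq _ x y _ (cst 1) (cst 1) (fun i => \1_(B i))) => //.
- exact: index_enum_uniq.
- by apply: (@integrable_bdd _ _ _ _ (cst 1) 1) => // w; rewrite normr1.
- by apply: (@integrable_bdd _ _ _ _ (cst 1) 1) => // w; rewrite normr1.
- move=> a th; under eq_Rintegral do rewrite mul1r.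
  by under [RHS]eq_Rintegral do rewrite mul1r.
- by move=> i; exact: bdd_meas_indic.
Qed.

Lemma measurable_preimage (d0 : measure_display) (T0 : measurableType d0)
    (z : T0 -> R) (B : set R) :
  measurable_fun setT z -> measurable B -> measurable (z @^-1` B).
Proof. by move=> mz mB; rewrite -[X in measurable X]setTI; exact: mz. Qed.

Lemma Rintegral_indic_preimage2 (d0 : measure_display) (T0 : measurableType d0)
    (Q : probability T0 R) (u v : T0 -> R) (B C : set R) :
  measurable_fun setT u -> measurable_fun setT v -> measurable B -> measurable C ->
  \int[Q]_w (\1_B (u w) * \1_C (v w)) = fine (Q (u @^-1` B `&` v @^-1` C)).
Proof.
move=> mu mv mB mC; rewrite /Rintegral.
rewrite -[in RHS](setIT (_ `&` _)) -integral_indic //; last first.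
  by apply: measurableI; exact: measurable_preimage.
by congr fine; apply: eq_integral => w _; rewrite indicI.
Qed.

Lemma integrable_bdd_meas_comp (d0 : measure_display) (T0 : measurableType d0)
    (Q : probability T0 R) (u : T0 -> R) (f : R -> R) :
  measurable_fun setT u -> bdd_meas f ->
  Q.-integrable setT (EFin \o (fun w => f (u w))).
Proof.
move=> mu [mf [M fM]]; apply: (@integrable_bdd _ _ _ _ (f \o u) M).
  exact: measurableT_comp.
by move=> w; exact: fM.
Qed.

(** Meant for the Markov kernel: its [phi] is a bounded function of the present rather than an
    indicator. *)
Lemma Rintegral_indicM_bdd_meas_eq (U V : T -> R) (U' V' : T' -> R) :
  measurable_fun setT U -> measurable_fun setT V ->
  measurable_fun setT U' -> measurable_fun setT V' ->
  (forall B C : set R, measurable B -> measurable C ->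
    P (U @^-1` B `&` V @^-1` C) = P' (U' @^-1` B `&` V' @^-1` C)) ->
  forall (B : set R) (g : R -> R), measurable B -> bdd_meas g ->
    \int[P]_w (\1_B (U w) * g (V w)) = \int[P']_w (\1_B (U' w) * g (V' w)).
Proof.
move=> mU mV mU' mV' H B g mB; move: g; apply: Rintegral_bdd_meas_eq => //.
- exact: integrable_bdd_meas_comp mU (bdd_meas_indic mB).
- exact: integrable_bdd_meas_comp mU' (bdd_meas_indic mB).
- by move=> C mC; rewrite !Rintegral_indic_preimage2 // H.
Qed.

Lemma Rintegral_mul_eq (U V : T -> R) (U' V' : T' -> R) :
  measurable_fun setT U -> measurable_fun setT V ->
  measurable_fun setT U' -> measurable_fun setT V' ->
  P.-integrable setT (EFin \o (fun w => U w * V w)) ->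
  P'.-integrable setT (EFin \o (fun w => U' w * V' w)) ->
  (forall B C : set R, measurable B -> measurable C ->
    P (U @^-1` B `&` V @^-1` C) = P' (U' @^-1` B `&` V' @^-1` C)) ->
  \int[P]_w (U w * V w) = \int[P']_w (U' w * V' w).
Proof.
move=> mU mV mU' mV' iUV iUV' H.
have step2 f g : bdd_meas f -> bdd_meas g ->
    \int[P]_w (g (V w) * f (U w)) = \int[P']_w (g (V' w) * f (U' w)).
  move=> bf bg; move: f bf; apply: Rintegral_bdd_meas_eq => //; [exact: integrable_bdd_meas_comp..|].
  move=> B mB; have := Rintegral_indicM_bdd_meas_eq mU mV mU' mV' H mB bg.
  under eq_Rintegral do rewrite mulrC.
  by under [RHS]eq_Rintegral do rewrite mulrC.
(* Each factor is truncated separately; as [tr] never increases the modulus, the integrable product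
   itself dominates. *)
pose tr (n : nat) (x : R) := x * \1_(`[- n%:R, n%:R]%classic) x.
have trle n x : `|tr n x| <= `|x|.
  rewrite /tr normrM -[leRHS]mulr1 ler_wpM2l //.
  by rewrite indicE; case: (_ \in _); rewrite ?normr1 ?normr0.
have btr n : bdd_meas (tr n).
  split; first by apply: measurable_funM => //; exact: measurable_indic.
  exists n%:R => x; rewrite /tr indicE mem_setE in_itv /=.
  have [h|_] := boolP (- n%:R <= x <= n%:R); last by rewrite mulr0 normr0.
  by rewrite mulr1 ler_norml.
have ctr x : tr n x @[n --> \oo] --> x.
  apply: cvg_near_cst.
  apply: filterS (nbhs_infty_ger `|x|) => n xn.
  by rewrite /tr indicE mem_set ?mulr1 //= in_itv /= -ler_norml.
have cvtr (d0 : measure_display) (T0 : measurableType d0) (Q : probability T0 R)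
    (u v : T0 -> R) : measurable_fun setT u -> measurable_fun setT v ->
    Q.-integrable setT (EFin \o (fun w => u w * v w)) ->
    (\int[Q]_w (tr n (v w) * tr n (u w))) @[n --> \oo] --> \int[Q]_w (u w * v w).
  move=> mu mv iuv.
  have iN : Q.-integrable setT (EFin \o (fun w => `|u w * v w|)).
    exact: (integrable_norm iuv).
  apply: (proj2 (Rintegral_cvg _ _ iN _)) => [n|w|n w].
  - apply: measurable_funM; apply: measurableT_comp => //; exact: (btr n).1.
  - by rewrite mulrC; apply: cvgM; exact: ctr.
  - by rewrite normrM [leRHS]normrM mulrC; apply: ler_pM.
have c1 := cvtr _ _ _ _ _ mU mV iUV.
have c2 := cvtr _ _ _ _ _ mU' mV' iUV'.
have E n := step2 _ _ (btr n) (btr n).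
move: c1; under eq_fun do rewrite E.
by move=> c1; exact: (cvg_unique _ c1 c2).
Qed.

End joint_law.

(** * Second moment of the normal law *)

Section normal_moment.
Context {R : realType}.
Local Notation mu := (@lebesgue_measure R).

Definition normal_moment2 (s : R) : \bar R :=
  (\int[mu]_x (x ^+ 2 * normal_pdf 0 s x)%:E)%E.

(** Change of variables holds for the Radon-Nikodym derivative, which agrees almost everywhere with
    [normal_pdf] because both have the same integral over every measurable set. *)
Lemma ge0_integral_normal_prob (s : R) (f : R -> R) : measurable_fun setT f ->
  (forall x, 0 <= f x) ->
  (\int[normal_prob 0 s]_x (f x)%:E = \int[mu]_x (f x * normal_pdf 0 s x)%:E)%E.
Proof.
move=> mf f0.
have dom := normal_prob_dominates 0 s.
have mp := measurable_normal_pdf 0 s.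
have mf' : measurable_fun setT (EFin \o f) by exact/measurable_EFinP.
rewrite -(Radon_Nikodym_SigmaFinite.change_of_variables dom) //=.
have irn := Radon_Nikodym_SigmaFinite.f_integrable dom.
apply: ae_eq_integral => //.
- by apply: emeasurable_funM => //; exact: (measurable_int mu irn).
- by apply/measurable_EFinP; exact: measurable_funM.
under [X in ae_eq _ _ _ X]eq_fun do rewrite EFinM.
apply: ae_eqe_mul2l; apply: integral_ae_eq => //.
- exact/measurable_EFinP.
- by move=> E _ mE; rewrite -Radon_Nikodym_SigmaFinite.f_integral.
Qed.

(* [x ^+ 2 <= 4 * expR (x ^+ 2 / 4)] reduces the moment to the density of standard deviation [sqrt 2]. *)
Lemma normal_moment2_lty : (normal_moment2 1 < +oo)%E.
Proof.
have s2 : (Num.sqrt 2 : R) != 0 by rewrite sqrtr_eq0 -ltNge.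
pose c : R := 4 * (normal_peak 1 / normal_peak (Num.sqrt 2)).
have c0 : 0 <= c by rewrite mulr_ge0 // divr_ge0 // normal_peak_ge0.
apply: (@le_lt_trans _ _ (\int[mu]_x (c * normal_pdf 0 (Num.sqrt 2) x)%:E)%E).
  apply: ge0_le_integral => //.
  - by move=> x _; rewrite lee_fin mulr_ge0 ?sqr_ge0 ?normal_pdf_ge0.
  - apply/measurable_EFinP; apply: measurable_funM; last exact: measurable_normal_pdf.
    exact: exprn_measurable.
  - apply/measurable_EFinP; apply: measurable_funM => //.
    exact: measurable_normal_pdf.
  move=> x _; rewrite lee_fin !normal_pdfE ?oner_eq0 //=.
  have p0 : normal_peak (Num.sqrt 2 : R) != 0 by rewrite gt_eqF // normal_peak_gt0.
  have -> : c * (normal_peak (Num.sqrt 2) * normal_fun 0 (Num.sqrt 2) x) =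
            normal_peak 1 * (4 * normal_fun 0 (Num.sqrt 2) x) by rewrite /c; field.
  rewrite mulrCA ler_wpM2l ?normal_peak_ge0 //.
  rewrite /normal_fun !subr0 sqr_sqrtr // expr1n.
  set y := x ^+ 2.
  have -> : - y / (1 *+ 2) = - (y / 4) + - (y / 4) by rewrite mulr2n; field.
  have -> : - y / (2 *+ 2) = - (y / 4) by rewrite mulr2n; field.
  rewrite expRD mulrA ler_wpM2r ?expR_ge0 // expRN ler_pdivrMr ?expR_gt0 //.
  have := expR_ge1Dx (y / 4); lra.
under eq_integral do rewrite EFinM.
rewrite integralZl //; last exact: integrable_normal_pdf.
by rewrite integral_normal_pdf mule1 ltry.
Qed.

(** On [1,2], an interval of length 1, the square is at least 1 and the density at least its value
    at 2. *)
Lemma normal_moment2_gt0 : (0 < normal_moment2 1)%E.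
Proof.
pose c : R := normal_pdf 0 1 2.
have pE x : normal_pdf (0:R) 1 x = normal_peak 1 * expR (- x ^+ 2 / 2).
  by rewrite normal_pdfE ?oner_eq0 // /normal_fun subr0 expr1n.
have c0 : 0 < c by rewrite /c pE mulr_gt0 ?expR_gt0 // normal_peak_gt0 ?oner_eq0.
have mg : measurable_fun setT (fun x : R => (x ^+ 2 * normal_pdf 0 1 x)%:E).
  apply/measurable_EFinP; apply: measurable_funM; last exact: measurable_normal_pdf.
  exact: exprn_measurable.
have g0 (x : R) : (0 <= (x ^+ 2 * normal_pdf 0 1 x)%:E)%E.
  by rewrite lee_fin mulr_ge0 ?sqr_ge0 ?normal_pdf_ge0.
apply: (@lt_le_trans _ _ (\int[mu]_(x in `[1%R, 2%R]) (x ^+ 2 * normal_pdf 0 1 x)%:E)%E); last first.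
  exact: ge0_subset_integral.
apply: (@lt_le_trans _ _ (\int[mu]_(x in `[1%R, 2%R]) c%:E)%E).
  rewrite integral_cst //= lebesgue_measure_itv /= lte_fin ltr1n -EFinB -EFinM lte_fin.
  by rewrite mulr_gt0 //; lra.
apply: ge0_le_integral => //.
- by move=> x _; rewrite lee_fin ltW.
- exact: measurable_funTS.
move=> x; rewrite /= in_itv /= => /andP[x1 x2]; rewrite lee_fin /c !pE.
rewrite mulrCA ler_wpM2l ?normal_peak_ge0 //.
rewrite -[leLHS]mul1r ler_pM ?expR_ge0 //; first by nra.
by rewrite ler_expR; nra.
Qed.

(** Under the substitution [x = s * y] the Jacobian cancels the factor [s^-1] of the peak, and the
    square leaves [s ^+ 2]. *)
Lemma normal_moment2_scale (s : R) : 0 < s ->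
  normal_moment2 s = ((s ^+ 2)%:E * normal_moment2 1)%E.
Proof.
move=> s0; have sn0 : s != 0 by rewrite gt_eqF.
pose F (x : R) : R := s * x.
have dF (x : R) : is_derive x 1 F s.
  by rewrite -[X in is_derive _ _ _ X]mulr1; exact: is_deriveZ.
have F'E : F^`()%classic = cst s.
  by apply/funext => x; rewrite derive1E; have [_ ->] := dF x.
pose G (x : R) := x ^+ 2 * normal_pdf 0 s x.
have G0 x : 0 <= G x by rewrite mulr_ge0 ?sqr_ge0 ?normal_pdf_ge0.
have cG : continuous G.
  move=> x; apply: cvgM; first exact: exprn_continuous.
  exact: continuous_normal_pdf.
rewrite /normal_moment2 (@increasing_ge0_integration_by_substitutionT _ F G) //.
- rewrite -ge0_integralZl //.
  + apply: eq_integral => x _; rewrite F'E /= -EFinM; congr EFin.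
    rewrite /G /F !normal_pdfE ?oner_eq0 // /normal_fun !subr0 expr1n.
    have -> : normal_peak s = s^-1 * normal_peak 1.
      rewrite /normal_peak expr1n mul1r -mulrnAr sqrtrM ?sqr_ge0 // sqrtr_sqr.
      by rewrite gtr0_norm // invfM.
    rewrite !fctE /= subr0.
    have -> : - (s * x) ^+ 2 / (s ^+ 2 *+ 2) = - x ^+ 2 / (1 *+ 2).
      by rewrite exprMn -(mulr_natr (s ^+ 2)); field.
    by field.
  + by apply/measurable_EFinP; apply: measurable_funM; [exact: exprn_measurable|exact: measurable_normal_pdf].
  + by move=> x _; rewrite lee_fin mulr_ge0 ?sqr_ge0 ?normal_pdf_ge0.
  + by rewrite lee_fin sqr_ge0.
- by move=> x y xy; rewrite /F ltr_pM2l.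
- by rewrite F'E => ?; exact: cvg_cst.
- by rewrite F'E; exact: is_cvg_cst.
- by rewrite F'E; exact: is_cvg_cst.
- rewrite /F; under eq_fun do rewrite mulrC.
  by apply/gt0_cvgMlNy => //; exact: cvg_id.
- rewrite /F; under eq_fun do rewrite mulrC.
  by apply/gt0_cvgMly => //; exact: cvg_id.
Qed.

End normal_moment.

(** * Covariances determine the laws of Gaussian families *)

Section gaussian_families.
Context {R : realType}.

Lemma normal_moment2_fineE :
  exists2 k : R, 0 < k & normal_moment2 (1 : R) = k%:E.
Proof.
have := @normal_moment2_lty R; have := @normal_moment2_gt0 R.
by case: (normal_moment2 1) => // k k0 _; exists k; rewrite ?lte_fin in k0 *.
Qed.

Context (d : measure_display) (T : measurableType d) (P : probability T R).

Lemma centered_normal_moment2 (Y : T -> R) (v : R) :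
  measurable_fun setT Y -> is_centered_normal P Y v ->
  (\int[P]_w (Y w ^+ 2)%:E = v%:E * normal_moment2 1)%E.
Proof.
move=> mY [v0 law].
have mY' : @measurable_fun _ _ T (measurableTypeR R) setT Y by exact: mY.
pose YRV : {mfun T >-> measurableTypeR R} := HB.pack Y (isMeasurableFun.Build _ _ T (measurableTypeR R) Y mY').
have msq : @measurable_fun _ _ (measurableTypeR R) _ setT (fun y : R => (y ^+ 2)%:E).
  by apply/measurable_EFinP; exact: exprn_measurable.
have -> : (\int[P]_w (Y w ^+ 2)%:E = \int[distribution P YRV]_y (y ^+ 2)%:E)%E.
  by rewrite ge0_integral_distribution // => y; rewrite lee_fin sqr_ge0.
have lawE A : measurable A -> distribution P YRV A = centered_normal_law v A.
  by move=> mA; exact: law.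
move: v0 lawE; rewrite /centered_normal_law le_eqVlt.
have [-> _ lawE|v_neq0] := eqVneq v 0.
  rewrite mul0e.
  transitivity (\int[\d_((0 : R)%R : measurableTypeR R)]_y (y ^+ 2)%:E)%E.
    by apply: eq_measure_integral => A mA _; exact: lawE.
  by rewrite integral_dirac // diracT mul1e expr0n.
move=> /= v0 lawE.
transitivity (\int[normal_prob 0 (Num.sqrt v)]_y (y ^+ 2)%:E)%E.
  by apply: eq_measure_integral => A mA _; exact: lawE.
have msqR : measurable_fun setT (fun y : R => y ^+ 2) by exact: exprn_measurable.
rewrite (ge0_integral_normal_prob _ msqR (@sqr_ge0 _)).
have := @normal_moment2_scale R (Num.sqrt v); rewrite sqrtr_gt0 => /(_ v0).
by rewrite sqr_sqrtr // ltW.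
Qed.

Lemma integrable_mul_of_sqr (Y Z : T -> R) :
  measurable_fun setT Y -> measurable_fun setT Z ->
  P.-integrable setT (EFin \o (fun w => Y w ^+ 2)) ->
  P.-integrable setT (EFin \o (fun w => Z w ^+ 2)) ->
  P.-integrable setT (EFin \o (fun w => Y w * Z w)).
Proof.
move=> mY mZ iY iZ.
apply: (le_integrable measurableT _ _ (integrableD measurableT iY iZ)).
  by apply/measurable_EFinP; exact: measurable_funM.
move=> w _; rewrite lee_fin /= [leRHS]ger0_norm ?addr_ge0 ?sqr_ge0 //.
have := sqr_ge0 (Y w - Z w); have := sqr_ge0 (Y w + Z w).
by rewrite ler_norml; nra.
Qed.

Lemma centered_normal_integrable_sqr (Y : T -> R) (v : R) :
  measurable_fun setT Y -> is_centered_normal P Y v ->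
  P.-integrable setT (EFin \o (fun w => Y w ^+ 2)).
Proof.
move=> mY nY; apply/integrableP; split.
  by apply/measurable_EFinP; exact: measurable_funX.
under eq_integral do rewrite /= ger0_norm ?sqr_ge0 //.
rewrite (centered_normal_moment2 mY nY).
by have [k _ ->] := normal_moment2_fineE; rewrite -EFinM ltry.
Qed.

Lemma Rintegral_sum (I : eqType) (s : seq I) (f : I -> T -> R) :
  (forall i, P.-integrable setT (EFin \o f i)) ->
  \int[P]_w (\sum_(i <- s) f i w) = \sum_(i <- s) \int[P]_w f i w.
Proof.
move=> i_f; rewrite /Rintegral; under eq_integral do rewrite -sumEFin.
rewrite integral_sum //; elim: s => [|i s IH]; first by rewrite !big_nil.
have i1 := integrable_fin_num measurableT (i_f i).
have i2 : (\sum_(j <- s) \int[P]_w (f j w)%:E)%E \is a fin_num.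
  by apply/sum_fin_numP => j _ _; exact: (integrable_fin_num measurableT (i_f j)).
by rewrite !big_cons fineD // IH.
Qed.

Lemma Rintegral_lin_comb_sqr (n : nat) (x : 'I_n -> T -> R) (a : 'I_n -> R) :
  (forall i j, P.-integrable setT (EFin \o (fun w => x i w * x j w))) ->
  \int[P]_w ((\sum_(i < n) a i * x i w) ^+ 2) =
  \sum_(i < n) \sum_(j < n) a i * a j * (\int[P]_w (x i w * x j w)).
Proof.
move=> ix.
have iax i j : P.-integrable setT (EFin \o (fun w => a i * a j * (x i w * x j w))).
  exact: (integrableZl measurableT _ (ix i j)).
under eq_Rintegral do rewrite expr2 big_distrlr.
rewrite Rintegral_sum => [|i].
  apply: eq_bigr => i _; rewrite Rintegral_sum => [|j].
    apply: eq_bigr => j _; rewrite -RintegralZl //.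
    by apply: eq_Rintegral => w _; rewrite mulrACA.
  move: (iax i j); congr (_.-integrable _ _).
  by apply/funext => w; rewrite /= mulrACA.
have -> : (EFin \o (fun w => \sum_(j < n) a i * x i w * (a j * x j w))) =
    (fun w => \sum_(j < n) (a i * a j * (x i w * x j w))%R%:E)%E.
  by apply/funext => w; rewrite /= sumEFin; congr EFin; apply: eq_bigr => j _; rewrite mulrACA.
by apply: integrable_sum => // j _; exact: iax.
Qed.

Definition gaussian_family (n : nat) (x : 'I_n -> T -> R) :=
  (forall i, measurable_fun setT (x i)) /\
  forall a : 'I_n -> R, exists v,
    is_centered_normal P (fun w => \sum_(i < n) a i * x i w) v.

Lemma gaussian_family_integrable (n : nat) (x : 'I_n -> T -> R) :
  gaussian_family x -> forall i j,
  P.-integrable setT (EFin \o (fun w => x i w * x j w)).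
Proof.
move=> [mx nx] i j.
have isq k : P.-integrable setT (EFin \o (fun w => x k w ^+ 2)).
  have [v] := nx (fun j => (j == k)%:R).
  have -> : (fun w => \sum_(j < n) (j == k)%:R * x j w) = x k.
    apply/funext => w; rewrite (bigD1 k) //= eqxx mul1r big1 ?addr0 // => l.
    by move=> /negbTE ->; rewrite mul0r.
  by apply: centered_normal_integrable_sqr.
exact: integrable_mul_of_sqr.
Qed.

End gaussian_families.

Section gaussian_two_spaces.
Context {R : realType} (d : measure_display) (T : measurableType d)
  (P : probability T R) (d' : measure_display) (T' : measurableType d')
  (P' : probability T' R).

Lemma centered_normal_Rintegral_cos (Y : T -> R) (Y' : T' -> R) (v th : R) :
  measurable_fun setT Y -> measurable_fun setT Y' ->
  is_centered_normal P Y v -> is_centered_normal P' Y' v ->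
  \int[P]_w cos (Y w + th) = \int[P']_w cos (Y' w + th).
Proof.
move=> mY mY' [_ lY] [_ lY'].
have bcos : bdd_meas (fun y : R => cos (y + th)).
  have := bdd_meas_sin (1 : R) (th + pi / 2).
  by under eq_fun do rewrite mul1r addrA sinDpihalf.
have mB (d0 : measure_display) (T0 : measurableType d0) (Q : probability T0 R)
    (Z : T0 -> R) (B : set R) :
    measurable_fun setT Z -> measurable B ->
    \int[Q]_w (cst 1 w * \1_B (Z w)) = fine (Q (Z @^-1` B)).
  move=> mZ mB; have mp := measurable_preimage mZ mB.
  rewrite /Rintegral -[in RHS](setIT (_ @^-1` _)) -integral_indic //.
  by congr fine; apply: eq_integral => w _; rewrite mul1r.
have i1 : P.-integrable setT (EFin \o cst (1 : R)).
  by apply: (@integrable_bdd _ _ _ _ (cst 1) 1) => // w; rewrite normr1.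
have i1' : P'.-integrable setT (EFin \o cst (1 : R)).
  by apply: (@integrable_bdd _ _ _ _ (cst 1) 1) => // w; rewrite normr1.
have H (B : set R) : measurable B ->
    \int[P]_w (cst 1 w * \1_B (Y w)) = \int[P']_w (cst 1 w * \1_B (Y' w)).
  by move=> HB; rewrite !mB // lY // lY'.
have := Rintegral_bdd_meas_eq i1 i1' mY mY' H bcos.
under eq_Rintegral do rewrite mul1r.
by under [RHS]eq_Rintegral do rewrite mul1r.
Qed.

Lemma centered_normal_variance_eq (Y : T -> R) (Y' : T' -> R) (v v' : R) :
  measurable_fun setT Y -> measurable_fun setT Y' ->
  is_centered_normal P Y v -> is_centered_normal P' Y' v' ->
  \int[P]_w (Y w ^+ 2) = \int[P']_w (Y' w ^+ 2) -> v = v'.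
Proof.
move=> mY mY' nY nY'; rewrite /Rintegral.
rewrite (centered_normal_moment2 mY nY) (centered_normal_moment2 mY' nY').
have [k k0 ->] := @normal_moment2_fineE R.
by move=> /= /mulIf; apply; rewrite gt_eqF.
Qed.

(** For each coefficient vector the covariances fix the second moment of the combination, hence its
    normal parameter, hence its cosine expectations. *)
Lemma gaussian_joint_law_eq (n : nat) (x : 'I_n -> T -> R) (y : 'I_n -> T' -> R) :
  gaussian_family P x -> gaussian_family P' y ->
  (forall i j, \int[P]_w (x i w * x j w) = \int[P']_w (y i w * y j w)) ->
  forall B : 'I_n -> set R, (forall i, measurable (B i)) ->
    P (\bigcap_(i in [set: 'I_n]) (x i @^-1` B i)) =
    P' (\bigcap_(i in [set: 'I_n]) (y i @^-1` B i)).
Proof.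
move=> gx gy E; apply: joint_law_eq; [exact: gx.1 | exact: gy.1 |] => a th.
have mX := measurable_lin_comb a (index_enum _) gx.1; have mY := measurable_lin_comb a (index_enum _) gy.1.
have [v nX] := gx.2 a; have [v' nY] := gy.2 a.
have vv' : v = v'.
  apply: (centered_normal_variance_eq mX mY nX nY).
  rewrite !Rintegral_lin_comb_sqr; [|exact: gaussian_family_integrable..].
  by apply: eq_bigr => i _; apply: eq_bigr => j _; rewrite E.
rewrite -vv' in nY.
exact: centered_normal_Rintegral_cos nX nY.
Qed.

End gaussian_two_spaces.

(** * Covariance of a Gaussian Markov process *)

Section pairs.
Context {R : realType} (d : measure_display) (T : measurableType d)
  (P : probability T R).

(** Stated for arbitrary variables because a regression residual is not a value of the process. *)
Definition gaussian_pair (U V : T -> R) :=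
  [/\ measurable_fun setT U, measurable_fun setT V &
    forall a b : R, exists v, is_centered_normal P (fun w => a * U w + b * V w) v].

Lemma gaussian_pair_family (U V : T -> R) : gaussian_pair U V ->
  gaussian_family P (fun (i : 'I_2) => if val i == 0%N then U else V).
Proof.
move=> [mU mV n]; split; first by move=> i; case: ifP.
move=> a; have [v nv] := n (a ord0) (a (lift ord0 ord0)); exists v.
by under eq_fun do rewrite !big_ord_recl big_ord0 /= addr0.
Qed.

Lemma gaussian_pair_integrable (U V : T -> R) : gaussian_pair U V ->
  [/\ P.-integrable setT (EFin \o (fun w => U w * U w)),
      P.-integrable setT (EFin \o (fun w => U w * V w)) &
      P.-integrable setT (EFin \o (fun w => V w * V w))].
Proof.
move=> /gaussian_pair_family/gaussian_family_integrable gi; split.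
- exact: (gi ord0 ord0).
- exact: (gi ord0 (lift ord0 ord0)).
- exact: (gi (lift ord0 ord0) (lift ord0 ord0)).
Qed.

Lemma Rintegral_lin2 (a b : R) (f g : T -> R) :
  P.-integrable setT (EFin \o f) -> P.-integrable setT (EFin \o g) ->
  P.-integrable setT (EFin \o (fun w => a * f w + b * g w)) /\
  \int[P]_w (a * f w + b * g w) = a * (\int[P]_w f w) + b * (\int[P]_w g w).
Proof.
move=> i_f i_g.
have ia := integrableZl measurableT a i_f; have ib := integrableZl measurableT b i_g.
split; first exact: (integrableD measurableT ia ib).
by rewrite Rintegral_lin // RintegralZl.
Qed.

End pairs.

Section pairs_law.
Context {R : realType} (d : measure_display) (T : measurableType d)
  (P : probability T R) (d' : measure_display) (T' : measurableType d')
  (P' : probability T' R).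

Lemma bigcap_ord2 (S : Type) (F : 'I_2 -> set S) :
  \bigcap_(i in [set: 'I_2]) F i = F ord0 `&` F (lift ord0 ord0).
Proof.
apply/seteqP; split => [w h|w [h0 h1] i _]; first by split; exact: h.
case: (unliftP ord0 i) => [j ->|-> //].
by rewrite (ord1 j).
Qed.

Lemma gaussian_pair_law_eq (U V : T -> R) (U' V' : T' -> R) :
  gaussian_pair P U V -> gaussian_pair P' U' V' ->
  \int[P]_w (U w * U w) = \int[P']_w (U' w * U' w) ->
  \int[P]_w (U w * V w) = \int[P']_w (U' w * V' w) ->
  \int[P]_w (V w * V w) = \int[P']_w (V' w * V' w) ->
  forall B C : set R, measurable B -> measurable C ->
    P (U @^-1` B `&` V @^-1` C) = P' (U' @^-1` B `&` V' @^-1` C).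
Proof.
move=> /gaussian_pair_family g /gaussian_pair_family g' EUU EUV EVV B C mB mC.
have := gaussian_joint_law_eq g g' _ (B := fun i => if val i == 0%N then B else C).
rewrite !bigcap_ord2; apply => [i j|i]; last by case: ifP.
have EVU : \int[P]_w (V w * U w) = \int[P']_w (V' w * U' w).
  under eq_Rintegral do rewrite mulrC.
  by under [RHS]eq_Rintegral do rewrite mulrC.
by case: ifP; case: ifP.
Qed.

End pairs_law.

Section markov_covariance.
Context {R : realType} (d : measure_display) (T : measurableType d)
  (P : probability T R) (X : R -> T -> R).

(** Puts events of the residual in the past of [t]. With that past as sigma-algebra on [T],
    membership becomes measurability, which linear combinations preserve. *)
Lemma nat_filtration_preimage_lin (s t a b : R) (B : set R) :
  0 <= s -> s <= t -> measurable B ->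
  nat_filtration X t ((fun w => a * X s w + b * X t w) @^-1` B).
Proof.
move=> s0 st mB; rewrite /nat_filtration.
set G := [set A | _].
have mXr r : 0 <= r -> r <= t ->
    measurable_fun (setT : set (g_sigma_algebraType G)) (X r).
  move=> r0 rt _ C mC; rewrite setTI; apply: sub_sigma_algebra.
  by exists r, C.
have mab : measurable_fun (setT : set (g_sigma_algebraType G))
    (fun w => a * X s w + b * X t w).
  apply: measurable_funD; apply: measurable_funM => //; apply: mXr => //.
  exact: le_trans st.
by have := mab measurableT B mB; rewrite setTI.
Qed.

Lemma centered_gaussian_pair (s t : R) : centered_gaussian_process P X ->
  0 <= s -> 0 <= t -> gaussian_pair P (X s) (X t).
Proof.
move=> [mX nX] s0 t0; split; [exact: mX|exact: mX|] => a b.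
have [|v nv] := nX 2%N (fun i => if val i == 0%N then a else b)
  (fun i => if val i == 0%N then s else t); first by move=> i; case: ifP.
by exists v; move: nv; under eq_fun do rewrite !big_ord_recl big_ord0 /= addr0.
Qed.

Lemma cov_funE (s t : R) : cov_fun P X s t = \int[P]_w (X s w * X t w).
Proof. by rewrite /cov_fun unlock. Qed.

Lemma cov_funC (s t : R) : cov_fun P X s t = cov_fun P X t s.
Proof. by rewrite !cov_funE; apply: eq_Rintegral => w _; rewrite mulrC. Qed.

Lemma cov_fun_ge0 (t : R) : 0 <= cov_fun P X t t.
Proof.
rewrite cov_funE; apply: Rintegral_ge0 => w _; rewrite -expr2; exact: sqr_ge0.
Qed.

Hypothesis gX : centered_gaussian_process P X.

Lemma cov_fun_lin (s t u a b : R) : 0 <= s -> 0 <= t -> 0 <= u ->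
  P.-integrable setT (EFin \o (fun w => (a * X s w + b * X t w) * X u w)) /\
  \int[P]_w ((a * X s w + b * X t w) * X u w) =
  a * cov_fun P X s u + b * cov_fun P X t u.
Proof.
move=> s0 t0 u0.
have [_ i1 _] := gaussian_pair_integrable (centered_gaussian_pair gX s0 u0).
have [_ i2 _] := gaussian_pair_integrable (centered_gaussian_pair gX t0 u0).
rewrite !cov_funE.
have -> : (fun w => (a * X s w + b * X t w) * X u w) =
    (fun w => a * (X s w * X u w) + b * (X t w * X u w)).
  by apply/funext => w; ring.
exact: Rintegral_lin2.
Qed.

Lemma cov_fun_cauchy_schwarz (s t : R) : 0 <= s -> 0 <= t ->
  cov_fun P X s t ^+ 2 <= cov_fun P X s s * cov_fun P X t t.
Proof.
move=> s0 t0.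
have quad a b : 0 <= a ^+ 2 * cov_fun P X s s + 2 * a * b * cov_fun P X s t +
                     b ^+ 2 * cov_fun P X t t.
  have [i1 E1] := cov_fun_lin a b s0 t0 s0.
  have [i2 E2] := cov_fun_lin a b s0 t0 t0.
  have [_ E] := Rintegral_lin2 a b i1 i2.
  have : 0 <= \int[P]_w (a * ((a * X s w + b * X t w) * X s w) +
                       b * ((a * X s w + b * X t w) * X t w)).
    apply: Rintegral_ge0 => w _.
    rewrite [X in 0 <= X](_ : _ = (a * X s w + b * X t w) ^+ 2); last by ring.
    exact: sqr_ge0.
  by rewrite E E1 E2 (cov_funC t s); congr (0 <= _); ring.
have := cov_fun_ge0 s; have := cov_fun_ge0 t.
set ct := cov_fun P X t t; set cs := cov_fun P X s s in quad *.
set c := cov_fun P X s t in quad *; move=> ct0 cs0.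
have [ct_eq0|ct_neq0] := eqVneq ct 0.
  have [-> |c_neq0] := eqVneq c 0; first by rewrite expr0n mulr_ge0.
  (* When [ct] is 0 the form is affine in its second argument; this choice would give it the value
     -1. *)
  have := quad 1 (- (cs + 1) / (2 * c)).
  rewrite -/ct ct_eq0 [X in 0 <= X](_ : _ = - 1); last by field.
  by rewrite oppr_ge0 ler10.
have ct_gt0 : 0 < ct by rewrite lt_neqAle eq_sym ct_neq0.
(* The minimiser of the form, scaled to avoid division, leaves the discriminant times [ct]. *)
have := quad ct (- c); rewrite -/ct.
rewrite [X in 0 <= X](_ : _ = ct * (cs * ct - c ^+ 2)); last by ring.
by rewrite pmulr_rge0 // subr_ge0.
Qed.

Hypothesis markovX : markov_process P X.

(* With [U] the residual of the regression of [X s] on [X t], the pairs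
   [(U, X t)] and [(- U, X t)] have the same law; the Markov property transfers
   this to [(U, X u)] and [(- U, X u)], so [U] and [X u] are uncorrelated. *)
Lemma markov_cov_fun (s t u : R) : 0 <= s -> s <= t -> t <= u ->
  cov_fun P X s u * cov_fun P X t t = cov_fun P X s t * cov_fun P X t u.
Proof.
move=> s0 st tu; have t0 := le_trans s0 st; have u0 := le_trans t0 tu.
have [ct0|ct0] := eqVneq (cov_fun P X t t) 0.
  have := cov_fun_cauchy_schwarz s0 t0; rewrite ct0 !mulr0 => cs.
  have /eqP : cov_fun P X s t ^+ 2 = 0 by apply/eqP; rewrite eq_le cs sqr_ge0.
  by rewrite expf_eq0 /= => /eqP ->; rewrite mul0r.
pose c := - (cov_fun P X s t / cov_fun P X t t).
have mXs := gX.1 s s0; have mXt := gX.1 t t0; have mXu := gX.1 u u0.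
(* The values 1 and -1 of [e] give the residual and its opposite, so each fact is proved once for
   both. *)
pose U (e : R) w := e * X s w + e * c * X t w.
have mU e : measurable_fun setT (U e).
  by apply: measurable_funD; apply: measurable_funM.
have gU e : gaussian_pair P (U e) (X t).
  split => // a b; have [_ _ /(_ (a * e) (a * e * c + b))[v nv]] :=
    centered_gaussian_pair gX s0 t0.
  exists v; move: nv; congr (is_centered_normal _ _ _).
  by apply/funext => w; rewrite /U; ring.
have UXr e r : 0 <= r -> P.-integrable setT (EFin \o (fun w => U e w * X r w)) /\
    \int[P]_w (U e w * X r w) = e * cov_fun P X s r + e * c * cov_fun P X t r.
  by move=> r0; exact: cov_fun_lin.
have UXt e : \int[P]_w (U e w * X t w) = 0.
  by rewrite (UXr e t t0).2 /c; field.
have UtE := gaussian_pair_law_eq (gU 1) (gU (- 1)) _ _ erefl.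
have {}UtE (B C : set R) : measurable B -> measurable C ->
    P (U 1 @^-1` B `&` X t @^-1` C) = P (U (- 1) @^-1` B `&` X t @^-1` C).
  apply: UtE; last by rewrite !UXt.
  by apply: eq_Rintegral => w _; rewrite /U; ring.
have UuE (B C : set R) : measurable B -> measurable C ->
    P (U 1 @^-1` B `&` X u @^-1` C) = P (U (- 1) @^-1` B `&` X u @^-1` C).
  move=> mB mC; have [phi [mphi phi01 phiE]] := markovX t0 tu mC.
  have bphi : bdd_meas phi.
    split => //; exists 1 => x; have /andP[p0 p1] := phi01 x.
    by rewrite ger0_norm.
  (* The event on [U e] lies in the past of [t], so the kernel replaces [X u] by a function of
     [X t]; only the law of [(U e, X t)] remains. *)
  have key e : P (U e @^-1` B `&` X u @^-1` C) =
      (\int[P]_w (\1_B (U e w) * phi (X t w)))%:E.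
    have mUB : measurable (U e @^-1` B) by exact: measurable_preimage.
    rewrite -[LHS]fineK ?fin_num_measure //; last first.
      by apply: measurableI => //; exact: measurable_preimage.
    rewrite phiE; last exact: nat_filtration_preimage_lin.
    congr EFin; rewrite -/(Rintegral _ _ _) Rintegral_mkcond.
    apply: eq_Rintegral => w _; rewrite patchE indicE.
    have -> : (w \in U e @^-1` B) = (U e w \in B) by apply/idP/idP; rewrite !in_setE.
    by case: ifP; rewrite ?mul1r ?mul0r.
  rewrite !key; congr EFin.
  exact: (Rintegral_indicM_bdd_meas_eq (mU _) mXt (mU _) mXt UtE mB bphi).
(* The covariance of the residual with [X u] equals its own opposite, hence vanishes. *)
have := Rintegral_mul_eq (mU 1) mXu (mU (- 1)) mXu (UXr 1 u u0).1 (UXr (- 1) u u0).1 UuE.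
rewrite !(UXr _ u u0).2 !mul1r !mulN1r => E.
have {}E : cov_fun P X s u + c * cov_fun P X t u = 0 by lra.
have -> : cov_fun P X s u = - (c * cov_fun P X t u) by lra.
by rewrite /c; field.
Qed.

End markov_covariance.

(** * Self-similar Markov kernels *)

Section self_similar_covariance.
Context {R : realType}.

(** Additivity and nonnegativity give monotonicity. With [m] the integer part of [n * a], both
    [n * g a] and [n * a * g 1] lie between [m * g 1] and [(m + 1) * g 1]; so [n] times the defect
    is at most [g 1] for every [n]. *)
Lemma additive_ge0_linear (g : R -> R) :
  (forall a b : R, 0 <= a -> 0 <= b -> g (a + b) = g a + g b) ->
  (forall a : R, 0 <= a -> 0 <= g a) -> forall a : R, 0 <= a -> g a = g 1 * a.
Proof.
move=> gD g0 a a0.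
have gn b n : 0 <= b -> g (n%:R * b) = n%:R * g b.
  move=> b0; elim: n => [|n IH].
    by have := gD 0 0 (lexx 0) (lexx 0); rewrite addr0 !mul0r; lra.
  by rewrite -natr1 mulrDl mul1r gD ?mulr_ge0 // IH; ring.
have gle b c : 0 <= b -> b <= c -> g b <= g c.
  move=> b0 bc; rewrite -(subrK b c) gD ?subr_ge0 // lerDr g0 // subr_ge0 //.
have k0 : 0 <= g 1 by exact: g0.
have bound n : n%:R * `|g a - g 1 * a| <= g 1.
  have na0 : 0 <= n%:R * a by rewrite mulr_ge0.
  have /andP[m1 m2] := truncn_itv na0.
  set m := Num.truncn _ in m1 m2.
  have h1 : m%:R * g 1 <= n%:R * g a.
    by rewrite -!gn // mulr1 gle.
  have h2 : n%:R * g a <= m.+1%:R * g 1.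
    by rewrite -!gn // mulr1 gle // ltW.
  rewrite -[X in X * _](@ger0_norm _ n%:R) // -normrM ler_norml.
  rewrite -natr1 in m2 h2; apply/andP; split; nra.
apply/eqP; rewrite -subr_eq0 -normr_le0 leNgt; apply/negP => d0.
have := bound (Num.truncn (g 1 / `|g a - g 1 * a|)).+1.
rewrite leNgt => /negP; apply; rewrite -ltr_pdivrMr //.
by have /andP[] := truncn_itv (divr_ge0 k0 (ltW d0)).
Qed.

(* In the variable [a = - ln x], [- ln r] is additive and at least [H * a] where finite, hence linear. *)
Lemma multiplicative_powR (r : R -> R) (H : R) :
  (forall x y : R, 0 < x <= 1 -> 0 < y <= 1 -> r (x * y) = r x * r y) ->
  (forall x : R, 0 < x <= 1 -> `|r x| <= x `^ H) -> 0 < H -> r 1 = 1 ->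
  (forall x : R, 0 < x < 1 -> r x = 0) \/
  (exists2 k, H <= k & forall x : R, 0 < x <= 1 -> r x = x `^ k).
Proof.
move=> rM rle H0 r1.
pose f a := r (expR (- a)).
have e01 (a : R) : 0 <= a -> 0 < expR (- a) <= 1.
  by move=> a0; rewrite expR_gt0 -expR0 ler_expR oppr_le0.
have fD a b : 0 <= a -> 0 <= b -> f (a + b) = f a * f b.
  by move=> a0 b0; rewrite /f opprD expRD rM // e01.
have f0 : f 0 = 1 by rewrite /f oppr0 expR0.
have fn a n : 0 <= a -> f (n%:R * a) = f a ^+ n.
  move=> a0; elim: n => [|n IH]; first by rewrite mul0r f0 expr0.
  by rewrite -natr1 mulrDl mul1r fD ?mulr_ge0 // IH exprSr.
have fge0 a : 0 <= a -> 0 <= f a.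
  move=> a0; have -> : a = 2%:R * (a / 2) by field.
  by rewrite fn ?divr_ge0 // exprn_even_ge0.
have fle a : 0 <= a -> f a <= expR (- (H * a)).
  move=> a0; have := rle _ (e01 a a0); rewrite -/(f a) ger0_norm ?fge0 //.
  by rewrite /powR gt_eqF ?expR_gt0 // expRK mulrN.
have xE (x : R) : 0 < x <= 1 -> exists2 a, 0 <= a & x = expR (- a).
  move=> /andP[x0 x1]; exists (- ln x); last by rewrite opprK lnK.
  by rewrite oppr_ge0 ln_le0.
(* A zero at [a] forces zeros at all [a / n], hence at points below any given [b > 0]; the
   factorisation of [f b] through such a point makes it vanish. *)
have [[a [a0 fa]]|nz] := pselect (exists a, 0 <= a /\ f a = 0).
  left => x /andP[x0 x1].
  have [|b b0 xb] := xE x; first by rewrite x0 ltW.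
  have b_gt0 : 0 < b.
    by move: x1; rewrite xb -expR0 ltr_expR oppr_lt0.
  pose n := (Num.truncn (a / b)).+1.
  have n0 : (0 : R) < n%:R by rewrite ltr0n.
  have an : a / n%:R <= b.
    rewrite ler_pdivrMr // mulrC -ler_pdivrMr // ltW //.
    by have /andP[] := truncn_itv (divr_ge0 a0 b0).
  have an0 : 0 <= a / n%:R by rewrite divr_ge0.
  have : f (a / n%:R) = 0.
    have := fn _ n an0; rewrite mulrC divfK ?gt_eqF // fa => /esym/eqP.
    by rewrite expf_eq0 => /andP[_ /eqP].
  rewrite xb -/(f b) -(subrK (a / n%:R) b) fD ?subr_ge0 // => ->.
  by rewrite mulr0.
have fgt0 a : 0 <= a -> 0 < f a.
  move=> a0; rewrite lt_neqAle fge0 // andbT eq_sym; apply/eqP => fa.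
  by apply: nz; exists a.
right; pose g a := - ln (f a).
have gD a b : 0 <= a -> 0 <= b -> g (a + b) = g a + g b.
  by move=> a0 b0; rewrite /g fD // lnM ?posrE ?fgt0 // opprD.
have gge a : 0 <= a -> H * a <= g a.
  move=> a0; rewrite lerNr -[leRHS]expRK ler_ln ?posrE ?expR_gt0 ?fgt0 //.
  exact: fle.
have glin := additive_ge0_linear gD _.
exists (g 1); first by have := gge 1 ler01; rewrite mulr1.
move=> x /xE[a a0 ->]; rewrite -/(f a).
rewrite /powR gt_eqF ?expR_gt0 // expRK mulrN -glin //; last first.
  by move=> b b0; apply: le_trans (gge b b0); rewrite mulr_ge0 // ltW.
by rewrite opprK lnK // posrE fgt0.
Qed.

(** The deterministic core: probability enters only through the five properties of the covariance
    assumed here. *)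
Lemma self_similar_markov_kernel (K : R -> R -> R) (H : R) : 0 < H ->
  (forall s t, K s t = K t s) -> 0 <= K 1 1 ->
  (forall s t : R, 0 <= s -> 0 <= t -> K s t ^+ 2 <= K s s * K t t) ->
  (forall a s t : R, 0 < a -> 0 <= s -> 0 <= t ->
     K (a * s) (a * t) = a `^ (2 * H) * K s t) ->
  (forall s t u : R, 0 <= s -> s <= t -> t <= u -> K s u * K t t = K s t * K t u) ->
  exists2 c : \bar R, (c <= (- H)%:E)%E &
    forall s t : R, 0 <= s -> 0 <= t -> K s t = K 1 1 * RHc H c s t.
Proof.
move=> H0 Ksym K11 Kcs Ksc Kmk.
have H2 : 2 * H != 0 by rewrite gt_eqF // mulr_gt0.
have K00 : K 0 0 = 0.
  have := Ksc 2 0 0 ltac:(lra) (lexx 0) (lexx 0); rewrite mulr0 => /eqP.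
  rewrite -subr_eq0 -{1}[K 0 0]mul1r -mulrBl mulf_eq0 => /orP[|/eqP //].
  rewrite subr_eq0 eq_sym powR_eq1 (negbTE H2) orbF => /orP[/eqP|]; lra.
have Kzero s t : 0 <= s -> 0 <= t -> K s s = 0 -> K s t = 0.
  move=> s0 t0 Kss; have := Kcs s t s0 t0; rewrite Kss mul0r => h.
  by have /eqP := @eq_refl _ (K s t); have : K s t ^+ 2 == 0;
     [rewrite eq_le h sqr_ge0 | rewrite expf_eq0 /= => /eqP].
have K0 t : 0 <= t -> K 0 t = 0 by move=> t0; exact: Kzero.
have Kdiag t : 0 < t -> K t t = t `^ (2 * H) * K 1 1.
  by move=> t0; rewrite -Ksc // mulr1.
have Kratio s t : 0 < s -> 0 < t -> K s t = t `^ (2 * H) * K (s / t) 1.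
  move=> s0 t0; rewrite -Ksc ?divr_ge0 ?ltW // mulr1 mulrC divfK //.
  by rewrite gt_eqF.
(* The boundary values vanish and [K] is symmetric, so only [0 < s <= t] matters. *)
have reduce c : (forall s t : R, 0 < s -> s <= t -> K s t = K 1 1 * RHc H c s t) ->
    forall s t : R, 0 <= s -> 0 <= t -> K s t = K 1 1 * RHc H c s t.
  move=> h.
  have RHc0 t : RHc H c 0 t = 0 :> R.
    rewrite /RHc; case: c {h} => [c| |] //.
      by rewrite lt_min ltxx.
    by case: eqP => // <-; rewrite powR0.
  have RHcC s t : RHc H c s t = RHc H c t s.
    rewrite /RHc; case: c {h RHc0} => [c| |] //; first by rewrite minC maxC.
    by rewrite eq_sym; case: eqP => // ->.
  move=> s t; rewrite !le_eqVlt => /predU1P[<-|s0].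
    by move=> t0; rewrite RHc0 mulr0 K0 // le_eqVlt.
  move=> /predU1P[<-|t0]; first by rewrite RHcC RHc0 mulr0 Ksym K0 // ltW.
  by have [st|/ltW ts] := leP s t; [exact: h | rewrite Ksym RHcC; exact: h].
have [K1|K1] := eqVneq (K 1 1) 0.
  (* In the degenerate case [K] vanishes identically and every admissible [c] would fit. *)
  exists -oo%E; first exact: leNye.
  apply: reduce => s t s0 st; rewrite K1 mul0r.
  apply: Kzero; [exact: ltW | exact: ltW (lt_le_trans s0 st) |].
  by rewrite Kdiag // K1 mulr0.
have K1p : 0 < K 1 1 by rewrite lt_neqAle eq_sym K1.
pose r x := K x 1 / K 1 1.
have KrE s t : 0 < s -> 0 < t -> K s t = K 1 1 * (t `^ (2 * H) * r (s / t)).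
  by move=> s0 t0; rewrite Kratio // /r; field.
have rM x y : 0 < x <= 1 -> 0 < y <= 1 -> r (x * y) = r x * r y.
  move=> /andP[x0 x1] /andP[y0 y1].
  have := Kmk (x * y) y 1 (ltW (mulr_gt0 x0 y0)) _ y1.
  rewrite ler_piMl // ?ltW // => /(_ isT).
  rewrite Kdiag // (Kratio (x * y) y) ?mulr_gt0 // mulfK ?gt_eqF // /r => E.
  have p : y `^ (2 * H) != 0 by rewrite gt_eqF // powR_gt0.
  apply: (mulfI p); apply: (mulIf K1); apply: (mulIf K1).
  transitivity (K (x * y) 1 * (y `^ (2 * H) * K 1 1)); first by field.
  by rewrite E; field.
have rle x : 0 < x <= 1 -> `|r x| <= x `^ H.
  move=> /andP[x0 x1].
  have := Kcs x 1 (ltW x0) ler01; rewrite Kdiag // => h.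
  rewrite -(@ler_pXn2r _ 2) ?nnegrE ?powR_ge0 // real_normK ?num_real //.
  rewrite /r expr_div_n ler_pdivrMr ?exprn_gt0 //.
  by move: h; rewrite (mulrC 2) powRrM powR_mulrn ?powR_ge0 // -mulrA -expr2.
have r1 : r 1 = 1 by rewrite /r divff.
have [r0|[k Hk rk]] := multiplicative_powR rM rle H0 r1.
  exists -oo%E; first exact: leNye.
  apply: reduce => s t s0 st; have t0 := lt_le_trans s0 st.
  rewrite KrE //= ; case: eqP => [->|/eqP s_neq_t].
    by rewrite divff ?gt_eqF // r1 mulr1.
  rewrite r0 ?mulr0 // divr_gt0 //= ltr_pdivrMr // mul1r lt_neqAle s_neq_t //.
(* For [s <= t] the kernel is proportional to [t]^ (2 * H) * (s / t) [^ k], which is the finite case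
   of [RHc] with [c = - k]. *)
exists (- k)%:E; first by rewrite lee_fin lerN2.
apply: reduce => s t s0 st; have t0 := lt_le_trans s0 st.
rewrite KrE //= rk ?divr_gt0 //= ?ler_pdivrMr ?mul1r //.
rewrite (min_idPl st) (max_idPr st) s0 opprK.
rewrite powRD; last by rewrite (gt_eqF t0) implybT.
rewrite powRM ?invr_ge0 ?ltW // -[t^-1](powR_inv1 (ltW t0)) -powRrM mulN1r.
by rewrite -mulrA (mulrC (s `^ k)).
Qed.

End self_similar_covariance.

(** * Scaling of the covariance and identification of the law *)

Section self_similar_process.
Context {R : realType} (d : measure_display) (T : measurableType d)
  (P : probability T R) (X : R -> T -> R).
Hypothesis gX : centered_gaussian_process P X.

Lemma self_similar_cov_fun (H a s t : R) : self_similar P X H ->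
  0 < a -> 0 <= s -> 0 <= t ->
  cov_fun P X (a * s) (a * t) = a `^ (2 * H) * cov_fun P X s t.
Proof.
move=> [_ ss] a0 s0 t0.
have as0 : 0 <= a * s by rewrite mulr_ge0 // ltW.
have at0 : 0 <= a * t by rewrite mulr_ge0 // ltW.
have mXs := gX.1 s s0; have mXt := gX.1 t t0.
have [_ i_a _] := gaussian_pair_integrable (centered_gaussian_pair gX as0 at0).
have [_ i1 _] := gaussian_pair_integrable (centered_gaussian_pair gX s0 t0).
have E : (fun w => a `^ H * X s w * (a `^ H * X t w)) =
         (fun w => a `^ (2 * H) * (X s w * X t w)).
  by apply/funext => w; rewrite mulrACA (mulrC 2) powRrM powR_mulrn ?powR_ge0 // expr2.
have i2 : P.-integrable setT (EFin \o (fun w => a `^ H * X s w * (a `^ H * X t w))).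
  by rewrite E; exact: (integrableZl measurableT _ i1).
rewrite !cov_funE (Rintegral_mul_eq _ _ _ _ i_a i2) ?E ?RintegralZl //.
- exact: gX.1.
- exact: gX.1.
- exact: measurable_funM.
- exact: measurable_funM.
move=> B C mB mC.
have := ss a a0 2%N (fun i => if val i == 0%N then s else t)
  (fun i => if val i == 0%N then B else C).
rewrite !bigcap_ord2; apply => i; by case: ifP.
Qed.

End self_similar_process.

(** The factor [k] is 1 for [X] and the square root of the variance at time 1 for [Y]. *)
Lemma gaussian_process_family {R : realType} (d : measure_display)
    (T : measurableType d) (P : probability T R) (X : R -> T -> R) (n : nat)
    (ts : 'I_n -> R) (k : R) :
  centered_gaussian_process P X -> (forall i, 0 <= ts i) ->
  gaussian_family P (fun i w => k * X (ts i) w).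
Proof.
move=> [mX nX] ts0; split => [i|a].
  by apply: measurable_funM => //; exact: mX.
have [v nv] := nX n (fun i => a i * k) ts ts0; exists v.
by under eq_fun do under eq_bigr do rewrite mulrA.
Qed.

Theorem theorem1 (R : realType) (d : measure_display) (T : measurableType d)
    (P : probability T R) (X : R -> T -> R) (H : R) :
  0 < H ->
  centered_gaussian_process P X ->
  self_similar P X H ->
  markov_process P X ->
  exists c : \bar R,
    [/\ (c <= (- H)%:E)%E,
        0 <= cov_fun P X 1 1,
        (forall s t : R, 0 <= s -> 0 <= t ->
           cov_fun P X s t = cov_fun P X 1 1 * RHc H c s t) &
        (forall (d' : measure_display) (T' : measurableType d')
                (P' : probability T' R) (Y : R -> T' -> R),
           centered_gaussian_process P' Y ->
           (forall s t : R, 0 <= s -> 0 <= t -> cov_fun P' Y s t = RHc H c s t) ->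
           same_law P X P' (fun t w => Num.sqrt (cov_fun P X 1 1) * Y t w))].
Proof.
move=> H0 gX ssX mkX; have v0 := cov_fun_ge0 P X 1.
have [c cH covE] := self_similar_markov_kernel H0 (cov_funC P X) v0
  (cov_fun_cauchy_schwarz gX) (fun a s t => self_similar_cov_fun gX ssX)
  (markov_cov_fun gX mkX).
exists c; split => // d' T' P' Y gY covY n ts B ts0 mB.
have fX : gaussian_family P (fun i => X (ts i)).
  have := gaussian_process_family 1 gX ts0; congr (gaussian_family _ _).
  by apply/funext => i; apply/funext => w; rewrite mul1r.
have fY := gaussian_process_family (Num.sqrt (cov_fun P X 1 1)) gY ts0.
apply: (gaussian_joint_law_eq fX fY) => // i j.
have [_ iY _] := gaussian_pair_integrable (centered_gaussian_pair gY (ts0 i) (ts0 j)).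
under [RHS]eq_Rintegral do rewrite mulrACA -expr2 sqr_sqrtr //.
by rewrite RintegralZl // -!cov_funE covE // covY.
Qed.
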